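(* Let $P_0$ and $Q_0$ be probability measures on measurable spaces $\mathcal{X}$ and $\mathcal{Y}$ respectively, and let $S:L^1(Q_0)\to L^1(P_0)$ be a coarsening satisfying the following two conditions. (A1) For all $h'\in E_{Q_0}$ with $h'\ge 0$ and $S(h')_{/\!/}>0$, there exists $h\in E_{Q_0}$, $h\ge 0$, with $S(h)=S(h')$ and $h_{/\!/}>0$. (A2) For all $g\in L^1(P_0)_+$ such that $S^*(g)=1$ and $g>0$, there exists a sequence $g_n\in L^1(P_0)_+$ such that $S^*(g_n)=\|g_n\|_1\cdot 1$, $g_n\lesssim g$ for every $n$, and $g_n\uparrow 1$. Then the CAR assumption cannot be tested, that is, the set $$\mathcal{P}_{\mathrm{CAR}}=\{g\cdot S(h): h\in\Delta_{Q_0},\ g\in L^1(P_0)_+,\ S^*(g)=1\}$$ is dense in $\Delta_{P_0}$ (for the $L^1(P_0)$-norm).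
   Context: All function inequalities are almost everywhere; $L^1(P)_+$ denotes the elements $f\ge 0$ of $L^1(P)$, and $f>0$ means strictly positive almost everywhere. $\langle f,g\rangle=\int fg$ denotes the duality pairing. For a probability measure $\nu$, $\Delta_\nu=\{h\in L^1(\nu):h\ge 0,\ \langle h,1\rangle=1\}$. A coarsening is a linear map $S:L^1(Q_0)\to L^1(P_0)$ that is positive ($h\ge 0\Rightarrow S(h)\ge 0$) and satisfies $S(1)=1$ and $S^*(1)=1$, where $S^*:L^\infty(P_0)\to L^\infty(Q_0)$ is the dual map, $\langle S(h),g\rangle=\langle h,S^*(g)\rangle$. The map $S^*$ extends to a continuous positive linear map $S^*:L^1(P_0)\to L^1(Q_0)$ (for $g\ge 0$, $S^*(g)$ is the increasing limit of $S^*(g_n)$ for any bounded $0\le g_n\uparrow g$); this extension is used in $S^*(g)$ for $g\in L^1(P_0)$. For a probability measure $P$, $E_P=(L^\infty(P))'$ is the Banach dual of $L^\infty(P)$, ordered by $h\ge 0$ iff $\langle h,\phi\rangle\ge 0$ for all $\phi\in L^\infty(P)$, $\phi\ge 0$; $L^1(P)\subset E_P$ in the canonical way, and $L^1(P)$ is a band in $E_P$. Each $h\in E_P$ with $h\ge 0$ decomposes uniquely as $h=h_{/\!/}+h_\perp$ with $h_{/\!/}\in L^1(P)_+$ and $h_\perp\ge 0$ disjoint from $L^1(P)$, i.e. $\inf(h_\perp,f)=0$ for all $f\in L^1(P)_+$. The coarsening $S$ is extended to $S:E_{Q_0}\to E_{P_0}$ as the dual of $S^*:L^\infty(P_0)\to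 L^\infty(Q_0)$, i.e. $\langle S(h),g\rangle=\langle h,S^*(g)\rangle$ for $g\in L^\infty(P_0)$; it is positive. For $h_1,h_2\in L^1(P)_+$, $h_2\lesssim h_1$ (''$h_1$ dominates $h_2$'') means there exists $R>0$ with $h_2\le R h_1$. $g_n\uparrow g$ denotes almost everywhere monotone increasing convergence. *)

(* Defs.v *)
From HB Require Import structures.
From mathcomp Require Import all_boot all_order all_algebra.
From mathcomp Require Import all_classical all_reals all_analysis.
From mathcomp Require Import ess_sup_inf measurable_realfun.

Set Implicit Arguments.
Unset Strict Implicit.
Unset Printing Implicit Defensive.

Import Order.TTheory GRing.Theory Num.Theory.
Import numFieldNormedType.Exports.

Local Open Scope classical_set_scope.
Local Open Scope ring_scope.

(* Elements of L^1(P) and L^oo(P) are handled through representatives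
   ([LfunType]); equality and order between them are always almost everywhere,
   and every map out of these spaces is required to respect a.e. equality. *)
Definition L1 d (T : measurableType d) (R : realType) (P : probability T R) :=
  LfunType P (lexx 1%E).
Definition Loo d (T : measurableType d) (R : realType) (P : probability T R) :=
  LfunType P (leey 1%E).

Section Lspaces.
Context d (T : measurableType d) (R : realType) (P : probability T R).
Implicit Types f g : T -> R.

Definition ae_ge0 f := \forall x \ae P, 0 <= f x.
Definition ae_gt0 f := \forall x \ae P, 0 < f x.

Definition norm1 f : R := fine 'N[P]_1[EFin \o f]%E.
Definition normoo f : R := fine 'N[P]_(+oo)[EFin \o f]%E.

Definition pairing f g : R := \int[P]_x (f x * g x).

Lemma finite_norm_cst p (c : R) : finite_norm P p (cst c).
Proof.
have P0 : (0 < P [set: T])%E by rewrite probability_setT.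
case: p => [r| |].
- by have /andP[_] := Lfun_cst P c r; rewrite inE.
- rewrite /finite_norm unlock P0 (_ : abse \o _ = cst `|c|%:E)//.
  by rewrite ess_sup_cst// ltry.
- rewrite /finite_norm unlock P0 (_ : abse \o _ = cst `|c|%:E)//.
  by rewrite ess_inf_cst// ltry.
Qed.

Lemma Lfun_cstP p (c : R) : (cst c : T -> R) \in Lfun P p.
Proof.
apply/andP; split; first by rewrite inE; exact: measurable_cst.
by rewrite inE; exact: finite_norm_cst.
Qed.

Definition L1cst (c : R) : L1 P := Lfun_Sub (lexx 1%E) (Lfun_cstP 1 c).
Definition Loocst (c : R) : Loo P := Lfun_Sub (leey 1%E) (Lfun_cstP +oo c).

(* The convex set Delta_P of probability densities. *)
Definition density : set (T -> R) :=
  [set f | [/\ f \in Lfun P 1, ae_ge0 f & \int[P]_x f x = 1]].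

Definition dominates f1 f2 :=
  exists2 r : R, 0 < r & \forall x \ae P, f2 x <= r * f1 x.

Definition ae_increases_to (g_ : (T -> R)^nat) g :=
  \forall x \ae P, {homo (fun n => g_ n x) : m n / (m <= n)%N >-> m <= n} /\
    (fun n => g_ n x) @ \oo --> g x.

End Lspaces.

Section dual.
Context d (T : measurableType d) (R : realType) (P : probability T R).

Lemma ae_le_normoo (phi : Loo P) : \forall x \ae P, `|phi x| <= normoo P phi.
Proof.
have P0 : (0 < P [set: T])%E by rewrite probability_setT.
have /= H := finite_norm_fine phi.
have := ess_sup_ge P (abse \o (EFin \o phi)).
apply: filterS => x /=.
have -> : ess_sup P (abse \o (EFin \o phi)) = 'N[P]_(+oo)[EFin \o phi]%E.
  by rewrite unlock P0.
by rewrite -H lee_fin.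
Qed.

Lemma normoo_le (phi : Loo P) (c : R) :
  (\forall x \ae P, `|phi x| <= c) -> normoo P phi <= c.
Proof.
have P0 : (0 < P [set: T])%E by rewrite probability_setT.
move=> H; rewrite -lee_fin finite_norm_fine unlock P0.
by apply/ess_supP; apply: filterS H => x /=; rewrite lee_fin.
Qed.

Lemma normoo_ge0 (phi : Loo P) : 0 <= normoo P phi.
Proof. by rewrite -lee_fin finite_norm_fine Lnorm_ge0. Qed.

Lemma measurable_L1 (f : L1 P) : measurable_fun setT f.
Proof. by have /andP[/[!inE]] := LfunP f. Qed.

Lemma measurable_Loo (f : Loo P) : measurable_fun setT f.
Proof. by have /andP[/[!inE]] := LfunP f. Qed.

Lemma integrable_pairing (f : L1 P) (phi : Loo P) :
  P.-integrable setT (EFin \o (f \* phi)).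
Proof.
have fi : P.-integrable setT (EFin \o f) by apply/Lfun1_integrable/LfunP.
have mfphi : measurable_fun setT (f \* phi : T -> R).
  by apply: measurable_funM; [exact: measurable_L1|exact: measurable_Loo].
have mnf : measurable_fun setT (fun x => `|f x| * normoo P phi).
  apply: measurable_funM => //; apply: measurableT_comp => //.
have /integrableP[_] := integrableZr measurableT (normoo P phi)
  (integrable_norm fi).
move=> ltoo; apply/integrableP; split; first exact/measurable_EFinP.
apply: le_lt_trans ltoo; apply: ae_ge0_le_integral => //.
- by apply: measurableT_comp => //; exact/measurable_EFinP.
- by apply: measurableT_comp => //; exact/measurable_EFinP.
apply: filterS (ae_le_normoo phi) => x xphi _ /=.
by rewrite lee_fin !normrM normr_id ler_wpM2l// (le_trans xphi)// ler_norm.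
Qed.

(* The Banach dual of L^oo(P): the linear functionals that are bounded for the
   essential supremum norm (hence invariant under a.e. equality). *)
Record dualLoo := DualLoo {
  dual_fun :> {scalar (Loo P)} ;
  dual_bounded : exists M : R, forall phi, `|dual_fun phi| <= M * normoo P phi
}.

Definition dual_eq (h k : dualLoo) := forall phi, h phi = k phi.

Definition dual_le (h k : dualLoo) :=
  forall phi : Loo P, ae_ge0 P phi -> h phi <= k phi.

Lemma dual0_bounded : exists M : R, forall phi : Loo P,
  `|(\0 : {scalar (Loo P)}) phi| <= M * normoo P phi.
Proof. by exists 0 => phi; rewrite /= normr0 mul0r. Qed.

Definition dual0 : dualLoo := DualLoo dual0_bounded.

Definition dual_is_inf (h k m : dualLoo) :=
  [/\ dual_le m h, dual_le m k &
      forall l, dual_le l h -> dual_le l k -> dual_le l m].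

Section L1_to_dual.
Variable f : L1 P.

Definition L1_fun (phi : Loo P) : R := pairing P f phi.

Lemma L1_fun_linear : linear_for *%R L1_fun.
Proof.
move=> a phi psi; rewrite /L1_fun /pairing.
have iphi := integrable_pairing f phi.
have ipsi := integrable_pairing f psi.
rewrite -RintegralZl// -RintegralD//; last exact: (integrableZl measurableT a iphi).
by apply: eq_Rintegral => x _ /=; rewrite mulrDr mulrCA.
Qed.

HB.instance Definition _ := GRing.isLinear.Build R (Loo P) R *%R
  L1_fun L1_fun_linear.

Lemma L1_fun_bounded : exists M : R, forall phi : Loo P,
  `|L1_fun phi| <= M * normoo P phi.
Proof.
have fi : P.-integrable setT (EFin \o f) by apply/Lfun1_integrable/LfunP.
exists (\int[P]_x `|f x|) => phi.
have ip := integrable_pairing f phi.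
have inp : P.-integrable setT (fun x => `|f x * phi x|%:E) by exact: integrable_norm ip.
have inf := integrableZr measurableT (normoo P phi) (integrable_norm fi).
rewrite /L1_fun /pairing (le_trans (le_normr_Rintegral _ ip))//.
rewrite -RintegralZr//; last exact: integrable_norm.
apply: fine_le; [exact: integrable_fin_num|exact: integrable_fin_num|].
apply: ae_ge0_le_integral => //.
- exact: measurable_int inp.
- by move=> x _; rewrite lee_fin mulr_ge0// normoo_ge0.
- exact: measurable_int inf.
apply: filterS (ae_le_normoo phi) => x xphi _ /=.
by rewrite lee_fin normrM ler_wpM2l.
Qed.

Definition L1_dual : dualLoo := DualLoo L1_fun_bounded.

End L1_to_dual.

Definition dual_ge0 (h : dualLoo) := dual_le dual0 h.

Definition singular (h : dualLoo) :=
  forall f : L1 P, ae_ge0 P f -> dual_is_inf h (L1_dual f) dual0.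

(* [ac_part h f]: f is the component h_// of h in the band L^1(P); the second
   component is h_perp. *)
Definition ac_part (h : dualLoo) (f : L1 P) := ae_ge0 P f /\
  exists k : dualLoo, [/\ dual_ge0 k, singular k &
    forall phi, h phi = L1_dual f phi + k phi].

(* h_// > 0; the decomposition of h >= 0 exists and is unique. *)
Definition ac_part_gt0 (h : dualLoo) := exists2 f, ac_part h f & ae_gt0 P f.

End dual.

Section Loo_separation.
Context d (T : measurableType d) (R : realType) (P : probability T R).

Lemma Loo_ge0P (k : Loo P) :
  (forall h : L1 P, ae_ge0 P h -> 0 <= pairing P h k) -> ae_ge0 P k.
Proof.
move=> H; pose A := [set x | k x < 0].
have mA : measurable A.
  rewrite (_ : A = k @^-1` `]-oo, 0[%classic); last first.
    by apply/seteqP; split => x; rewrite /A /= in_itv.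
  by rewrite -[X in measurable X]setTI; exact: measurable_Loo.
have iA : (\1_A : T -> R) \in Lfun P 1.
  by apply/Lfun1_integrable/integrable_indic => //; rewrite probability_fin.
pose h : L1 P := Lfun_Sub (lexx 1%E) iA.
have h0 : ae_ge0 P h by apply: nearW => x /=; rewrite indicE.
have ih := integrable_pairing h k.
have hk0 (x : T) : (h x * k x <= 0)%R.
  rewrite /= indicE; have [|] := boolP (x \in A); last by rewrite mul0r.
  by rewrite inE mul1r => /ltW.
have abs0 : (\int[P]_x `|(h x * k x)%:E| = 0)%E.
  apply/eqP; rewrite eq_le integral_ge0// andbT.
  have -> : (\int[P]_x `|(h x * k x)%:E| = \int[P]_x ((- 1)%:E * (h x * k x)%:E))%E.
    by apply: eq_integral => x _; rewrite lee0_abs ?lee_fin// EFinN mulN1e.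
  rewrite (integralZl measurableT ih) EFinN mulN1e leeNl oppe0.
  have := H h h0; rewrite -lee_fin /pairing /Rintegral fineK//.
  exact: (integrable_fin_num measurableT ih).
have /(ae_eq_integral_abs _ measurableT (measurable_int _ ih)) := abs0.
apply: filterS => x /(_ I) /= /eqP; rewrite eqe indicE => hk.
rewrite leNgt; apply/negP => kx0; move: hk.
by rewrite mem_set// mul1r => /eqP kx; move: kx0; rewrite kx ltxx.
Qed.

End Loo_separation.

Definition ae_linear d d' (X : measurableType d) (Y : measurableType d')
    (R : realType) (P : probability X R) (Q : probability Y R)
    (T : L1 Q -> L1 P) :=
  (forall h k : L1 Q, h = k %[ae Q] -> T h = T k %[ae P]) /\
  (forall (a : R) (h k : L1 Q), T (a *: h + k) = a *: T h + T k %[ae P]).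

(* A coarsening together with its dual map S^*, which exists for every positive
   linear S and is unique up to a.e. equality. *)
Record coarsening d d' (X : measurableType d) (Y : measurableType d')
    (R : realType) (P : probability X R) (Q : probability Y R) := Coarsening {
  coars :> L1 Q -> L1 P ;
  coars_linear : ae_linear coars ;
  coars_ge0 : forall h : L1 Q, ae_ge0 Q h -> ae_ge0 P (coars h) ;
  coars1 : coars (L1cst Q 1) = cst 1 %[ae P] ;
  coars_adj : Loo P -> Loo Q ;
  coars_adjE : forall (h : L1 Q) (g : Loo P),
    pairing P (coars h) g = pairing Q h (coars_adj g) ;
  coars_adj1 : coars_adj (Loocst P 1) = cst 1 %[ae Q]
}.

Section pairing_dual.
Context d (T : measurableType d) (R : realType) (P : probability T R).

Lemma pairingD (h : L1 P) (a : R) (phi psi : Loo P) :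
  pairing P h (a *: phi + psi) = a * pairing P h phi + pairing P h psi.
Proof. exact: (L1_fun_linear h a phi psi). Qed.

Lemma pairingZ (h : L1 P) (a : R) (phi : Loo P) :
  pairing P h (a *: phi) = a * pairing P h phi.
Proof.
have p0 : pairing P h (0 : Loo P) = 0 by exact: (linear0 (L1_dual h)).
by rewrite -[a *: phi]addr0 pairingD p0 addr0.
Qed.

Lemma pairing_ge0 (h : L1 P) (k : Loo P) :
  ae_ge0 P h -> ae_ge0 P k -> 0 <= pairing P h k.
Proof.
move=> h0 k0; have mhk := measurable_int _ (integrable_pairing h k).
rewrite /pairing /Rintegral fine_ge0//.
rewrite (ae_eq_integral (fun x => `|(h x * k x)%:E|%E))//.
- exact: integral_ge0.
- exact: measurableT_comp mhk.
by apply: filterS2 h0 k0 => x hx kx _; rewrite gee0_abs// lee_fin mulr_ge0.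
Qed.

Lemma pairing_inj (k1 k2 : Loo P) :
  (forall h : L1 P, pairing P h k1 = pairing P h k2) -> k1 = k2 %[ae P].
Proof.
move=> H.
have H12 (h : L1 P) : 0 <= pairing P h ((-1) *: k2 + k1).
  by rewrite pairingD H mulN1r addNr.
have H21 (h : L1 P) : 0 <= pairing P h ((-1) *: k1 + k2).
  by rewrite pairingD H mulN1r addNr.
have K12 := Loo_ge0P (fun h _ => H12 h).
have K21 := Loo_ge0P (fun h _ => H21 h).
near=> x => _; apply/eqP; rewrite eq_le; apply/andP; split.
- rewrite -subr_ge0 addrC.
  suff -> : - k1 x + k2 x = ((-1) *: k1 + k2) x by near: x.
  by rewrite /= scaleN1r.
- rewrite -subr_ge0 addrC.
  suff -> : - k2 x + k1 x = ((-1) *: k2 + k1) x by near: x.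
  by rewrite /= scaleN1r.
Unshelve. all: by end_near. Qed.

Lemma dual_ae (h : dualLoo P) (phi psi : Loo P) :
  phi = psi %[ae P] -> h phi = h psi.
Proof.
move=> e; have [M hM] := dual_bounded h.
have n0 : normoo P (phi - psi) = 0.
  apply/eqP; rewrite eq_le normoo_ge0 andbT; apply: normoo_le.
  apply: filterS e => x /(_ I) exy.
  by rewrite (_ : (phi - psi) x = phi x - psi x)// exy subrr normr0.
by have := hM (phi - psi); rewrite n0 mulr0 normr_le0 linearB subr_eq0 => /eqP.
Qed.

End pairing_dual.

Section extension.
Context d d' (X : measurableType d) (Y : measurableType d') (R : realType).
Context (P : probability X R) (Q : probability Y R) (S : coarsening P Q).

Lemma coars_adj_linear (a : R) (phi psi : Loo P) :
  coars_adj S (a *: phi + psi) = a *: coars_adj S phi + coars_adj S psi %[ae Q].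
Proof.
by apply: pairing_inj => h; rewrite -coars_adjE !pairingD -!coars_adjE.
Qed.

Lemma coars_adj_bounded (phi : Loo P) :
  normoo Q (coars_adj S phi) <= normoo P phi.
Proof.
set c := normoo P phi.
have K (s : R) : s ^+ 2 = 1 -> \forall y \ae Q, s * coars_adj S phi y <= c.
  move=> s2.
  have u0 : ae_ge0 P ((- s) *: phi + c *: Loocst P 1 : Loo P).
    apply: filterS (ae_le_normoo phi) => x phic.
    have s1 : `|s| = 1.
      by apply/eqP; rewrite -(@eqrXn2 _ 2)// -normrX s2 normr1 expr1n.
    suff : 0 <= - s * phi x + c * 1 by [].
    rewrite mulr1 mulNr addrC subr_ge0.
    by rewrite (le_trans (ler_norm _))// normrM s1 mul1r.
  have adj1 (h : L1 Q) :
      pairing Q h (coars_adj S (Loocst P 1)) = pairing Q h (Loocst Q 1).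
    exact: (dual_ae (L1_dual h) (psi := Loocst Q 1) (coars_adj1 S)).
  have : ae_ge0 Q ((- s) *: coars_adj S phi + c *: Loocst Q 1 : Loo Q).
    apply: Loo_ge0P => h h0; rewrite pairingD.
    rewrite pairingZ -adj1 -!coars_adjE -(pairingZ _ c) -pairingD.
    exact: pairing_ge0 (coars_ge0 S h0) u0.
  apply: filterS => y y0.
  have : 0 <= - s * coars_adj S phi y + c * 1 by [].
  by rewrite mulr1 mulNr addrC subr_ge0.
apply: normoo_le; have /K Kp : 1 ^+ 2 = 1 :> R by rewrite expr1n.
have /K Kn : (-1) ^+ 2 = 1 :> R by rewrite sqrrN expr1n.
apply: filterS2 Kp Kn => y; rewrite mul1r mulN1r => yc ycN.
by rewrite ler_norml yc andbT lerNl.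
Qed.

Definition coars_dual_fun (h : dualLoo Q) (phi : Loo P) : R :=
  h (coars_adj S phi).

Lemma coars_dual_linear (h : dualLoo Q) : linear_for *%R (coars_dual_fun h).
Proof.
by move=> a phi psi; rewrite /coars_dual_fun (dual_ae h (coars_adj_linear _ _ _)) linearP.
Qed.

HB.instance Definition _ (h : dualLoo Q) := GRing.isLinear.Build R (Loo P) R *%R
  (coars_dual_fun h) (coars_dual_linear h).

Lemma coars_dual_bounded (h : dualLoo Q) : exists M : R, forall phi : Loo P,
  `|coars_dual_fun h phi| <= M * normoo P phi.
Proof.
have [M hM] := dual_bounded h; exists `|M| => phi.
rewrite (le_trans (hM _))// (@le_trans _ _ (`|M| * normoo Q (coars_adj S phi)))//.
  by rewrite ler_wpM2r ?normoo_ge0// ler_norm.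
by rewrite ler_wpM2l// coars_adj_bounded.
Qed.

Definition coars_dual (h : dualLoo Q) : dualLoo P :=
  DualLoo (coars_dual_bounded h).

Lemma coars_dual_L1 (h : L1 Q) :
  dual_eq (coars_dual (L1_dual h)) (L1_dual (S h)).
Proof. by move=> phi; rewrite /= /coars_dual_fun /L1_fun coars_adjE. Qed.

(* [adj_L1 Sx]: Sx is the continuous positive linear extension to L^1(P) of the
   dual map S^* of S. *)
Record adj_L1 (Sx : L1 P -> L1 Q) : Prop := AdjL1 {
  adj_L1_linear : ae_linear Sx ;
  adj_L1_ge0 : forall g : L1 P, ae_ge0 P g -> ae_ge0 Q (Sx g) ;
  adj_L1_continuous : forall (g : L1 P) (e : R), 0 < e ->
    exists2 delta : R, 0 < delta & forall g' : L1 P,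
      norm1 P (g' - g) < delta -> norm1 Q (Sx g' - Sx g) < e ;
  adj_L1_ext : forall (g : L1 P) (phi : Loo P), g = phi %[ae P] ->
    Sx g = coars_adj S phi %[ae Q] ;
  adj_L1_increasing : forall (g : L1 P) (g_ : (Loo P)^nat),
    (forall n, ae_ge0 P (g_ n)) -> ae_increases_to P (fun n => g_ n) g ->
    ae_increases_to Q (fun n => coars_adj S (g_ n)) (Sx g)
}.

(* The set P_CAR, for S^* = Sx on L^1(P). *)
Definition CAR (Sx : L1 P -> L1 Q) : set (X -> R) :=
  [set p | exists (h : L1 Q) (g : L1 P),
    [/\ density Q h, ae_ge0 P g, Sx g = cst 1 %[ae Q] & p = g \* S h]].

End extension.

(* A is a dense subset of B for the L^1(P)-norm. *)
Definition L1_dense_in d (T : measurableType d) (R : realType)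
    (P : probability T R) (A B : set (T -> R)) :=
  A `<=` B /\ forall f, B f -> forall e : R, 0 < e ->
    exists2 p, A p & ('N[P]_1[EFin \o (f \- p)%R] < e%:E)%E.

(* Main.v *)
From HB Require Import structures.
Require Import Defs.
From mathcomp Require Import all_boot all_order all_algebra.
From mathcomp Require Import all_classical all_reals all_analysis.
From mathcomp Require Import ess_sup_inf measurable_realfun ring lra.

Set Implicit Arguments.
Unset Strict Implicit.
Unset Printing Implicit Defensive.

Import Order.TTheory GRing.Theory Num.Theory.
Import numFieldNormedType.Exports.

Local Open Scope classical_set_scope.
Local Open Scope ring_scope.

(** The idea is maximum likelihood. Densities [f] with [a <= f <= b] for some
    [a > 0] are dense, so fix such an [f] and maximize [L h := int f ln (S h)]
    over the densities [h] of [Q0]. If [h] were a maximizer, then [s := S h]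
    would satisfy the Kuhn-Tucker inequalities [int (f / s) S k <= 1] for all
    densities [k], with equality for [k = h]; hence [g := f / s] would satisfy
    [S^* g <= 1], with equality where [h > 0], and [f = g s] would be a CAR
    density.

    A maximizer need not exist, but a fast maximizing sequence [h_n] behaves
    almost as well. Strict concavity of the logarithm makes [ln (S h_n)] a
    Cauchy sequence almost everywhere ([ln_midpoint_gap], [log_optimal]), so
    [S h_n] converges almost everywhere to some [s > 0], and the Kuhn-Tucker
    inequalities survive in the limit by Fatou's lemma. With [g := f / s] this
    gives [S^* g <= 1].

    For the equality [S^* g = 1] the sequence [h_n] gets a limit [h'] in the
    dual of [L^oo], along an ultrafilter ([density_ultralimit]). The absolutely
    continuous part of [S h'] is exactly [s], because the part of [S h_n] that
    fails to converge weakly to [s] lives on sets of vanishing measure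
    ([ac_part_ae_limit]). Assumption (A1) replaces [h'] by [h] with [S h = S h']
    and [h_// > 0]. Then [1 = int f = int g s <= <h, S^* g>] in a truncated
    sense, while [<h, 1> = 1] and [S^* g <= 1], which forces [S^* g = 1] where
    [h_// > 0], that is, almost everywhere ([saturation]).

    Finally each [g S(h_n)] is a CAR density, with integral [1 = int f] by
    duality ([CAR_mass]), and [g S(h_n)] converges to [g s = f] almost
    everywhere. By [scheffe] the convergence holds in [L^1]. *)

(** * Real-valued integrals and almost everywhere relations *)

Section real_integrals.
Context d (T : measurableType d) (R : realType) (P : probability T R).
Implicit Types f g : T -> R.

Local Notation integrable f := (P.-integrable setT (EFin \o f)).

Lemma integrable_measurable f : integrable f -> measurable_fun setT f.
Proof. by move/measurable_int/measurable_EFinP. Qed.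

Lemma integrable_normr f : integrable f -> integrable (fun x => `|f x|).
Proof. by move=> intf; exact: (integrable_norm intf). Qed.

Lemma Rintegrable_cst (c : R) : integrable (fun=> c).
Proof. exact: finite_measure_integrable_cst. Qed.

Lemma RintegrableD f g : integrable f -> integrable g ->
  integrable (fun x => f x + g x).
Proof. by move=> intf intg; exact: (integrableD measurableT intf intg). Qed.

Lemma RintegrableB f g : integrable f -> integrable g ->
  integrable (fun x => f x - g x).
Proof. by move=> intf intg; exact: (integrableB measurableT intf intg). Qed.

Lemma RintegrableZl (c : R) f : integrable f -> integrable (fun x => c * f x).
Proof. exact: (integrableZl measurableT c). Qed.

Lemma RintegrableZr (c : R) f : integrable f -> integrable (fun x => f x * c).
Proof. exact: (integrableZr measurableT c). Qed.

Lemma integrable_dominated f g : measurable_fun setT f ->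
  (\forall x \ae P, `|f x| <= g x) -> integrable g -> integrable f.
Proof.
move=> mf fg ig; have mg := integrable_measurable ig.
apply/integrableP; split; first exact/measurable_EFinP.
have /integrableP[_] := ig; apply: le_lt_trans.
apply: ae_ge0_le_integral => //.
- by apply: measurableT_comp => //; exact/measurable_EFinP.
- by apply: measurableT_comp => //; exact/measurable_EFinP.
by apply: filterS fg => x fg _ /=; rewrite lee_fin (le_trans fg)// ler_norm.
Qed.

Lemma integrable_bounded f (c : R) : measurable_fun setT f ->
  (\forall x \ae P, `|f x| <= c) -> integrable f.
Proof.
move=> mf fc; apply: (integrable_dominated mf fc).
exact: finite_measure_integrable_cst.
Qed.

Lemma integrableM_bounded f g (c : R) : integrable f -> measurable_fun setT g ->
  (\forall x \ae P, `|g x| <= c) -> integrable (f \* g).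
Proof.
move=> intf mg gc; have mf := integrable_measurable intf.
apply: (@integrable_dominated _ (fun x => `|f x| * c)).
- exact: measurable_funM.
- by apply: filterS gc => x gc /=; rewrite normrM ler_wpM2l.
- exact: (integrableZr measurableT c (integrable_norm intf)).
Qed.

Lemma ae_eq_Rintegral f g : measurable_fun setT f -> measurable_fun setT g ->
  (\forall x \ae P, f x = g x) -> \int[P]_x f x = \int[P]_x g x.
Proof.
move=> mf mg fg; congr fine; apply: ae_eq_integral => //.
- exact/measurable_EFinP.
- exact/measurable_EFinP.
- by apply: filterS fg => x fg _ /=; rewrite fg.
Qed.

Lemma ae_le_Rintegral f g : integrable f -> integrable g ->
  (\forall x \ae P, f x <= g x) -> \int[P]_x f x <= \int[P]_x g x.
Proof.
move=> intf intg fg.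
have mf := integrable_measurable intf; have mg := integrable_measurable intg.
have mm : measurable_fun setT (fun x => Num.max (f x) (g x)).
  exact: measurable_maxr.
have <- : \int[P]_x Num.max (f x) (g x) = \int[P]_x g x.
  by apply: ae_eq_Rintegral => //; apply: filterS fg => x /max_idPr.
apply: le_Rintegral => //.
- apply: (@integrable_dominated _ (fun x => `|f x| + `|g x|)) => //.
    apply: nearW => x; case: (leP (f x) (g x)) => _.
      by rewrite lerDr.
    by rewrite lerDl.
  exact: (RintegrableD (integrable_normr intf) (integrable_normr intg)).
- by move=> x _; rewrite le_max lexx.
Qed.

Lemma ae_Rintegral_ge0 f : integrable f -> (\forall x \ae P, 0 <= f x) ->
  0 <= \int[P]_x f x.
Proof.
move=> intf f0; have := ae_le_Rintegral _ intf f0.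
rewrite Rintegral_cst// mul0r; apply.
exact: finite_measure_integrable_cst.
Qed.

Lemma EFin_Rintegral f : integrable f ->
  (\int[P]_x (f x)%:E)%E = (\int[P]_x f x)%:E.
Proof. by move=> intf; rewrite fineK//; exact: integrable_fin_num. Qed.

Lemma Rintegral_prob_cst (c : R) : \int[P]_x (cst c x) = c.
Proof.
by rewrite Rintegral_cst// -[X in _ * fine X]/(P setT) probability_setT mulr1.
Qed.

Lemma ae_eq0_Rintegral f : integrable f -> (\forall x \ae P, 0 <= f x) ->
  \int[P]_x f x <= 0 -> \forall x \ae P, f x = 0.
Proof.
move=> intf f0 I0; have mf := integrable_measurable intf.
have /(ae_eq_integral_abs _ measurableT _) : (\int[P]_x `|(f x)%:E| = 0)%E.
  rewrite (ae_eq_integral (EFin \o f))//.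
  - rewrite EFin_Rintegral//; congr EFin.
    by apply/eqP; rewrite eq_le I0 ae_Rintegral_ge0.
  - by apply: measurableT_comp => //; exact/measurable_EFinP.
  - exact/measurable_EFinP.
  - by apply: filterS f0 => x f0 _ /=; rewrite ger0_norm.
move=> /(_ (measurable_int _ intf)); apply: filterS => x /(_ I) /=.
by case.
Qed.

(** Fatou's lemma, with integrals bounded along a filter [F] finer than that of
    the neighbourhoods of infinity. Taking for [F] an ultrafilter bounds the
    integral of an almost everywhere limit by a weak limit. *)
Lemma Rfatou (F : set_system nat) (u_ : nat -> T -> R) (u : T -> R)
    (c_ : nat -> R) (c : R) : ProperFilter F -> F `=>` \oo ->
  (forall n, integrable (u_ n)) -> measurable_fun setT u ->
  (forall n, \forall x \ae P, 0 <= u_ n x) ->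
  (\forall x \ae P, (fun n => u_ n x) @ \oo --> u x) ->
  (forall n, \int[P]_x u_ n x <= c_ n) -> c_ @ F --> c ->
  integrable u /\ \int[P]_x u x <= c.
Proof.
move=> PF Foo iu mu u0 uu uc cc.
have u0' : \forall x \ae P, forall n, 0 <= u_ n x by exact: ae_foralln.
have mu_ n := integrable_measurable (iu n).
have mau n : measurable_fun setT (fun x => `|u_ n x|%:E).
  by apply/measurable_EFinP; exact: measurableT_comp.
have fatou_u : (\int[P]_x `|(u x)%:E| <=
    limn_einf (fun n => (\int[P]_x u_ n x)%:E))%E.
  have := @fatou _ _ _ P setT measurableT (fun n x => `|u_ n x|%:E) mau
    (fun n x _ => normr_ge0 _).
  rewrite (_ : (fun n => _) = (fun n => (\int[P]_x u_ n x)%:E)); last first.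
    apply/funext => n; rewrite -EFin_Rintegral//.
    apply: ae_eq_integral => //; first exact/measurable_EFinP.
    by apply: filterS (u0 n) => x ux _ /=; rewrite ger0_norm.
  apply: le_trans; rewrite le_eqVlt; apply/orP; left; apply/eqP.
  apply: ae_eq_integral => //.
  - by apply: measurableT_comp => //; exact/measurable_EFinP.
  - rewrite /limn_einf; apply: measurableT_comp => //.
    apply: measurable_fun_limn_esup => n.
    by apply: measurableT_comp => //; exact: mau.
  - apply: filterS uu => x uu _ /=.
    have /cvg_limn_einf_sup[-> _]// :
        (fun n => `|u_ n x|%:E) @ \oo --> `|u x|%:E.
    by apply: cvg_EFin; [apply: nearW|exact: cvg_norm].
have le_c : (\int[P]_x `|(u x)%:E| <= c%:E)%E.
  rewrite leNgt; apply/negP => /lt_le_trans/(_ fatou_u).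
  rewrite limn_einf_lim (cvg_lim _ (@cvg_einfs_sup _ _))//.
  move=> /ereal_sup_gt[_ [n _ <-]] clt.
  have : (einfs (fun n => (\int[P]_x u_ n x)%:E) n <= c%:E)%E.
    apply: (@cvge_to_ge _ F _ R (fun k => (c_ k)%:E)).
      by apply: cvg_EFin => //; exact: nearW.
    have : F [set k | (n <= k)%N] by apply: Foo; exists n.
    apply: filterS => k /= nk; apply: (@le_trans _ _ (\int[P]_x u_ k x)%:E).
      by apply: ereal_inf_lbound; exists k.
    by rewrite lee_fin.
  by rewrite leNgt clt.
have intu : integrable u.
  apply/integrableP; split; first exact/measurable_EFinP.
  exact: le_lt_trans le_c (ltry _).
split=> //; rewrite -lee_fin -EFin_Rintegral//.
apply: le_trans le_c; have inu := integrable_normr intu.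
rewrite [leRHS](EFin_Rintegral inu) EFin_Rintegral// lee_fin.
by apply: le_Rintegral => // x _; exact: ler_norm.
Qed.

Lemma Rdominated_convergence (u_ : nat -> T -> R) (u g : T -> R) :
  (forall n, measurable_fun setT (u_ n)) -> measurable_fun setT u ->
  (\forall x \ae P, (fun n => u_ n x) @ \oo --> u x) -> integrable g ->
  (forall n, \forall x \ae P, `|u_ n x| <= g x) ->
  [/\ integrable u,
      (fun n => \int[P]_x `|u_ n x - u x|) @ \oo --> 0 &
      (fun n => \int[P]_x u_ n x) @ \oo --> \int[P]_x u x].
Proof.
move=> mu_ mu uu ig ug.
have iu_ n := integrable_dominated (mu_ n) (ug n) ig.
have [] := @dominated_convergence _ _ _ P setT measurableT
  (fun n x => (u_ n x)%:E) (EFin \o u) (EFin \o g).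
- by move=> n; exact/measurable_EFinP.
- exact/measurable_EFinP.
- by apply: filterS uu => x ux _; apply: cvg_EFin; [apply: nearW|].
- exact: ig.
- by apply: filterS (ae_foralln ug) => x ux n _ /=; rewrite lee_fin.
move=> iu c0 c1; split => //; first exact: (fine_cvg c0).
by apply: fine_cvg; rewrite -EFin_Rintegral.
Qed.

(** Almost everywhere convergence of densities implies convergence in norm:
    as [u - u_n] has integral zero, its norm is twice the integral of its
    positive part, which is dominated by [u]. *)
Lemma scheffe (u_ : nat -> T -> R) (u : T -> R) :
  (forall n, integrable (u_ n)) -> integrable u ->
  (forall n, \forall x \ae P, 0 <= u_ n x) -> (\forall x \ae P, 0 <= u x) ->
  (\forall x \ae P, (fun n => u_ n x) @ \oo --> u x) ->
  (forall n, \int[P]_x u_ n x = \int[P]_x u x) ->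
  (fun n => \int[P]_x `|u x - u_ n x|) @ \oo --> 0.
Proof.
move=> iu_ iu u_0 u0 uu eqI.
have mu_ n := integrable_measurable (iu_ n).
have mu := integrable_measurable iu.
(* [w n] is twice the positive part of [u - u_n]. *)
pose w n x := `|u x - u_ n x| + (u x - u_ n x).
have mw n : measurable_fun setT (w n).
  by apply: measurable_funD; [apply: measurableT_comp => //|];
    exact: measurable_funB.
have wle n : \forall x \ae P, `|w n x| <= u x + u x.
  apply: filterS2 (u_0 n) u0 => x h1 h2; rewrite /w.
  have du : u x - u_ n x <= u x by rewrite gerBl.
  have [h|h] := ler0P (u x - u_ n x).
    by rewrite addrC subrr normr0 addr_ge0.
  by rewrite (gtr0_norm (addr_gt0 h h)) lerD.
have [iw _ cw] : [/\ integrable (fun n => 0 : R),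
    (fun n => \int[P]_x `|w n x - 0|) @ \oo --> 0 &
    (fun n => \int[P]_x w n x) @ \oo --> \int[P]_x 0].
  apply: Rdominated_convergence wle => //; last exact: RintegrableD.
  apply: filterS uu => x ux.
  rewrite [X in _ --> X](_ : 0 = `|u x - u x| + (u x - u x)); last first.
    by rewrite subrr normr0 addr0.
  by apply: cvgD; [apply: cvg_norm|]; apply: cvgB => //; exact: cvg_cst.
have iB n : integrable (u \- u_ n) := (integrableB measurableT iu (iu_ n)).
have eqw n : \int[P]_x `|u x - u_ n x| = \int[P]_x w n x.
  rewrite (RintegralD measurableT (integrable_normr (iB n)) (iB n)).
  by rewrite RintegralB// eqI subrr addr0.
by under eq_fun do rewrite eqw; rewrite Rintegral_prob_cst in cw.
Qed.

End real_integrals.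

(** * Strict concavity of the logarithm *)

Section logarithm.
Context {R : realType}.
Implicit Types p q y : R.

Lemma expRD_expRN_ge y : 2 + y ^+ 2 <= expR (y * 2) + expR (- (y * 2)).
Proof.
have ee : expR y * expR (- y) = 1 by rewrite -expRD subrr expR0.
have E2 z : expR (z * 2) = expR z ^+ 2 :> R.
  by rewrite mulr2n mulrDr mulr1 expRD expr2.
rewrite -mulNr !E2; set e := expR y in ee *; set e' := expR (- y) in ee *.
have : y ^+ 2 <= (e - e') ^+ 2.
  have [y0|y0] := leP 0 y.
    have := expR_ge1Dx y; have : e' <= 1 by rewrite expR_le1 oppr_le0.
    rewrite -/e => h1 h2; nra.
  have := expR_ge1Dx (- y); have : e <= 1 by rewrite expR_le1 ltW.
  rewrite -/e' => h1 h2; nra.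
by nra.
Qed.

(** Quantitative strict concavity at [expR p] and [expR q]. With
    [y = (p - q) / 4] one has [expR D = cosh (2 y) >= 1 + y ^+ 2 / 2], and the
    convexity inequality [1 - D <= expR (- D)] turns this lower bound for
    [expR D - 1] into one for [D]. The factor [expR D] is harmless where [D] is
    bounded. *)
Lemma ln_midpoint_gap p q (D := ln ((expR p + expR q) / 2) - (p + q) / 2) :
  0 <= D /\ (p - q) ^+ 2 <= 32 * (D * expR D).
Proof.
have gap : (p - q) ^+ 2 <= 32 * (expR D - 1).
  have -> : expR D = (expR ((p - q) / 4 * 2) + expR (- ((p - q) / 4 * 2))) / 2.
    rewrite /D expRD lnK ?posrE ?divr_gt0 ?addr_gt0 ?expR_gt0//.
    rewrite mulrAC mulrDl -!expRD.
    by congr ((expR _ + expR _) / _); field.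
  have := expRD_expRN_ge ((p - q) / 4); lra.
have D1 : expR D - 1 <= D * expR D.
  have := expR_ge1Dx (- D).
  rewrite expRN => h; have e0 := expR_gt0 D.
  have : (1 - D) * expR D <= (expR D)^-1 * expR D by rewrite ler_pM2r.
  rewrite mulVf ?gt_eqF//; lra.
have e1 : 1 <= expR D by have := sqr_ge0 (p - q); lra.
split; last lra.
by move: e1; rewrite -[X in X <= _](@expR0 R) ler_expR.
Qed.

(** [ln x <= x - 1] at [x = 1 / (1 + y)]. *)
Lemma ln_ge_ratio y : 0 <= y -> y / (1 + y) <= ln (1 + y).
Proof.
move=> y0; have y1 : 0 < 1 + y by lra.
have : ln (1 + y)^-1 <= (1 + y)^-1 - 1.
  rewrite -{1}(subrK 1 (1 + y)^-1) addrC le_ln1Dx// ltrBrDl subrr invr_gt0//.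
rewrite lnV ?posrE//.
have -> : y / (1 + y) = 1 - (1 + y)^-1 by field; lra.
lra.
Qed.

Lemma ln_le_id y : 0 < y -> ln y <= y.
Proof.
move=> y0; have : -1 < y - 1 by lra.
by move=> /le_ln1Dx; rewrite addrC subrK; lra.
Qed.

End logarithm.

Lemma cvg_geometric_increments (R : realType) (l : R^nat) (B : R) :
  (forall n, `|l n.+1 - l n| <= B / 2 ^+ n) -> cvgn l.
Proof.
move=> lB.
have -> : l = (fun n => l 0%N + series (telescope l) n).
  by apply/funext => n; exact: eq_sum_telescope.
apply: is_cvgD; first exact: is_cvg_cst.
apply: normed_cvg; apply: (@series_le_cvg _ _ (geometric B 2^-1)) => //.
- by move=> n; exact: normr_ge0.
- by move=> n; rewrite /= /geometric exprVn; exact: le_trans (lB n).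
- by move=> n; rewrite /= /geometric exprVn; exact: lB.
- by apply: is_cvg_geometric_series; rewrite ger0_norm ?invr_ge0//; lra.
Qed.

(** The sum of the [f_n] has a finite integral, so it is finite almost
    everywhere, and it bounds each of its terms. *)
Lemma ae_bounded_geometric d (T : measurableType d) (R : realType)
    (P : probability T R) (f_ : nat -> T -> R) :
  (forall n, P.-integrable setT (EFin \o f_ n)) -> (forall n x, 0 <= f_ n x) ->
  (forall n, \int[P]_x f_ n x <= (2^-1) ^+ n) ->
  \forall x \ae P, exists C, forall n, f_ n x <= C.
Proof.
move=> intf f0 If.
pose F x := (\sum_(0 <= n <oo) (f_ n x)%:E)%E.
have mf n : measurable_fun setT (fun x => (f_ n x)%:E).
  by apply/measurable_EFinP; exact: integrable_measurable (intf n).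
have F0 x : (0 <= F x)%E by apply: nneseries_ge0 => n _ _; rewrite lee_fin.
have iF : P.-integrable setT F.
  apply/integrableP; split.
    by apply: ge0_emeasurable_sum => // n x _ _; rewrite lee_fin.
  under eq_integral do rewrite gee0_abs//.
  rewrite integral_nneseries//; last by move=> n x _; rewrite lee_fin.
  apply: (@le_lt_trans _ _ (\sum_(0 <= n <oo) (2 / (2 ^ (n + 1))%:R)%:E)%E).
    apply: lee_nneseries => [n _ _|n _].
      by apply: integral_ge0 => x _; rewrite lee_fin.
    rewrite EFin_Rintegral// lee_fin (le_trans (If n))// addn1 expnS.
    by rewrite natrM natrX invfM mulrA mulfV ?mul1r ?exprVn// pnatr_eq0.
  have := @cvg_geometric_eseries_half R 2 0.
  by move=> /cvg_lim ->//; rewrite ltry.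
apply: filterS (integrable_ae measurableT iF) => x /(_ I) Fx.
exists (fine (F x)) => n; rewrite -lee_fin fineK//.
have := @nneseries_lim_ge R (fun k => (f_ k x)%:E) xpredT 0 n.+1.
move=> /(_ (fun k _ _ => f0 k x)); apply: le_trans.
rewrite big_nat_recr//= leeDr// sume_ge0// => k _; exact: f0.
Qed.

(** * Log-optimal sequences in a convex set of densities *)

Section log_optimal.
Context d (T : measurableType d) (R : realType) (P : probability T R).

Local Notation integrable f := (P.-integrable setT (EFin \o f)).

Lemma measurable_inv_pos (u : T -> R) : measurable_fun setT u ->
  (forall x, 0 < u x) -> measurable_fun setT (fun x => (u x)^-1).
Proof.
move=> mu u0; rewrite (_ : (fun _ => _) = expR \o (fun x => - ln (u x))).
  apply: measurableT_comp => //; apply: measurableT_comp => //.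
  exact: measurableT_comp.
by apply/funext => x /=; rewrite expRN lnK ?posrE.
Qed.

Variables (f : T -> R) (a b : R).
Hypotheses (mf : measurable_fun setT f) (a_gt0 : 0 < a)
  (f_ge : forall x, a <= f x) (f_le : forall x, f x <= b)
  (If : \int[P]_x f x = 1).

Variable K : set (T -> R).
Hypothesis K_ex : K !=set0.
Hypothesis K_measurable : forall u, K u -> measurable_fun setT u.
Hypothesis K_bounded_below : forall u, K u ->
  exists2 c, 0 < c & forall x, c <= u x.
Hypothesis K_integrable : forall u, K u -> integrable u.
Hypothesis K_mass : forall u, K u -> \int[P]_x u x = 1.
Hypothesis K_convex : forall u v (r : R), 0 < r -> K u -> K v ->
  K (fun x => (u x + r * v x) / (1 + r)).

Let f_gt0 x : 0 < f x. Proof. exact: lt_le_trans a_gt0 (f_ge x). Qed.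

Let f_norm : \forall x \ae P, `|f x| <= b.
Proof. by apply: nearW => x; rewrite gtr0_norm. Qed.

Let intf : integrable f. Proof. exact: integrable_bounded f_norm. Qed.

Let intM u : integrable u -> integrable (fun x => u x * f x).
Proof. by move=> iu; exact: (integrableM_bounded iu mf f_norm). Qed.

Let K_gt0 u x : K u -> 0 < u x.
Proof. by move=> /K_bounded_below[c c0 cu]; exact: lt_le_trans (cu x). Qed.

Let L (u : T -> R) := \int[P]_x (ln (u x) * f x).

(* Above, [ln u <= u]; below, [ln u] is bounded because [u] stays away
   from zero. *)
Let integrable_ln u : K u -> integrable (fun x => ln (u x)).
Proof.
move=> Ku; have [c c0 cu] := K_bounded_below Ku.
apply: (@integrable_dominated _ _ _ P _ (fun x => u x + `|ln c|)).
- by apply: measurableT_comp => //; exact: K_measurable.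
- apply: nearW => x; have ux := K_gt0 x Ku.
  have h1 := ln_le_id ux.
  have h2 : ln c <= ln (u x) by rewrite ler_ln ?posrE.
  have h3 : - `|ln c| <= ln c by rewrite lerNl -normrN ler_norm.
  have h4 := normr_ge0 (ln c).
  by rewrite ler_norml; apply/andP; split; lra.
by apply: RintegrableD; [exact: K_integrable|exact: Rintegrable_cst].
Qed.

Let L_le u : K u -> L u <= b.
Proof.
move=> Ku; apply: (@le_trans _ _ (\int[P]_x (u x * b))).
  apply: le_Rintegral => //.
  - exact: intM (integrable_ln Ku).
  - exact: (RintegrableZr b (K_integrable Ku)).
  - move=> x _; have ux := K_gt0 x Ku; have h1 := ln_le_id ux.
    apply: (@le_trans _ _ (u x * f x)); first by rewrite ler_pM2r.
    by rewrite ler_pM2l.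
by rewrite RintegralZr ?K_mass ?mul1r//; exact: K_integrable.
Qed.

Let sup_L := sup [set L u | u in K].

Let has_sup_L : has_sup [set L u | u in K].
Proof.
split; first by have [u Ku] := K_ex; exists (L u), u.
by exists b => _ [u Ku <-]; exact: L_le.
Qed.

Let le_sup_L u : K u -> L u <= sup_L.
Proof. by move=> Ku; apply: sup_upper_bound => //; exists u. Qed.

Let near_optimal (e : R) : 0 < e -> exists2 u, K u & sup_L - e < L u.
Proof.
move=> e0; have [_ [u Ku <-] h] := sup_adherent e0 has_sup_L.
by exists u.
Qed.

Let K_convex1 u v : K u -> K v -> K (fun x => (u x + v x) / 2).
Proof.
move=> Ku Kv; have := K_convex ltr01 Ku Kv.
by congr K; apply/funext => x; rewrite mul1r.
Qed.

(* Kuhn-Tucker inequality for a near-maximizer [u], obtained by comparing [u]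
   with [w = (u + r v) / (1 + r)]: the gain [L w - L u] is at most [e], while
   [ln (1 + y) >= y / (1 + y)] at [y = r v / u] bounds it from below. *)
Let near_optimal_ratio u v (e r : R) : K u -> K v -> 0 < r ->
  sup_L - e <= L u ->
  integrable (fun x => v x / (u x + r * v x) * f x) /\
  \int[P]_x (v x / (u x + r * v x) * f x) <= e / r + 1.
Proof.
move=> Ku Kv r0 Lu; have r1 : 0 < 1 + r by lra.
have Kw := K_convex r0 Ku Kv; set w := fun x => _ in Kw.
have wE x : ln (u x + r * v x) = ln (w x) + ln (1 + r).
  by rewrite -lnM ?posrE ?(K_gt0 x Kw)// /w divfK// gt_eqF.
have uv0 x : 0 < u x + r * v x.
  by have ux := K_gt0 x Ku; have vx := K_gt0 x Kv; rewrite addr_gt0 ?mulr_gt0.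
have mv := K_measurable Kv; have mu := K_measurable Ku.
have iw : integrable (fun x => v x / (u x + r * v x) * f x).
  apply: intM; apply: (@integrable_bounded _ _ _ P _ r^-1).
    apply: measurable_funM => //; apply: measurable_inv_pos => //.
    by apply: measurable_funD => //; exact: measurable_funM.
  apply: nearW => x; have vx := K_gt0 x Kv; have ux := K_gt0 x Ku.
  have h0 : 0 <= v x / (u x + r * v x) by rewrite divr_ge0// ltW.
  rewrite ger0_norm// ler_pdivrMr// mulrDr mulKf ?gt_eqF//.
  by rewrite lerDr mulr_ge0 ?invr_ge0// ltW.
split => //.
have iLw := intM (integrable_ln Kw); have iLu := intM (integrable_ln Ku).
have ilf : integrable (fun x => ln (1 + r) * f x).
  exact: (RintegrableZl (ln (1 + r)) intf).
have : \int[P]_x (r * (v x / (u x + r * v x) * f x)) <=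
    \int[P]_x (ln (w x) * f x + ln (1 + r) * f x - ln (u x) * f x).
  apply: le_Rintegral => //.
  - exact: (RintegrableZl r iw).
  - exact: (RintegrableB (RintegrableD iLw ilf) iLu).
  move=> x _; rewrite -mulrDl -wE -mulrBl mulrA ler_pM2r//.
  have ux := K_gt0 x Ku; have vx := K_gt0 x Kv.
  rewrite -ln_div ?posrE//.
  have -> : (u x + r * v x) / u x = 1 + r * v x / u x by field; rewrite gt_eqF.
  have -> : r * (v x / (u x + r * v x)) =
      r * v x / u x / (1 + r * v x / u x).
    by field; rewrite !gt_eqF.
  by apply: ln_ge_ratio; rewrite divr_ge0 ?mulr_ge0// ltW.
rewrite RintegralZl// RintegralB//; last first.
  exact: (RintegrableD iLw ilf).
rewrite RintegralD// RintegralZl// If mulr1 => h.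
have hw := le_sup_L Kw; rewrite -/(L w) -/(L u) in h.
have hr : ln (1 + r) <= r by apply: le_ln1Dx; lra.
rewrite -(ler_pM2l r0) mulrDr mulrCA divff ?gt_eqF// !mulr1; lra.
Qed.

(* The midpoint of two near-maximizers cannot beat the supremum. *)
Let midpoint_gap u v (e : R)
    (D := fun x => ln ((u x + v x) / 2) - (ln (u x) + ln (v x)) / 2) :
  K u -> K v -> sup_L - e <= L u -> sup_L - e <= L v ->
  integrable D /\ a * \int[P]_x D x <= e.
Proof.
move=> Ku Kv Lu Lv; have Kw := K_convex1 Ku Kv; set w := fun x => _ in Kw.
have iD : integrable D.
  apply: (RintegrableB (integrable_ln Kw)).
  apply: (RintegrableZr 2^-1).
  exact: (RintegrableD (integrable_ln Ku) (integrable_ln Kv)).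
have iLw := intM (integrable_ln Kw); have iLu := intM (integrable_ln Ku).
have iLv := intM (integrable_ln Kv).
have iLuv : integrable (fun x => (ln (u x) * f x + ln (v x) * f x) / 2).
  by apply: (RintegrableZr 2^-1); exact: (RintegrableD iLu iLv).
split => //; rewrite -RintegralZl//.
have : \int[P]_x (a * D x) <=
   \int[P]_x (ln (w x) * f x - (ln (u x) * f x + ln (v x) * f x) / 2).
  apply: le_Rintegral => //.
  - exact: (RintegrableZl a iD).
  - exact: (RintegrableB iLw iLuv).
  move=> x _; have ux := K_gt0 x Ku; have vx := K_gt0 x Kv.
  have [D0 _] := ln_midpoint_gap (ln (u x)) (ln (v x)).
  rewrite !lnK ?posrE// in D0.
  have -> : ln (w x) * f x - (ln (u x) * f x + ln (v x) * f x) / 2 = f x * D x.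
    by rewrite /D -/(w x); ring.
  exact: ler_wpM2r.
rewrite RintegralB// RintegralZr//; last exact: (RintegrableD iLu iLv).
rewrite RintegralD// -/(L u) -/(L v) -/(L w).
have := le_sup_L Kw; lra.
Qed.

(** Choose [u_n] within [e_n := a / 8 ^+ n] of the supremum of [L]. The
    midpoint gaps [D_n] of consecutive terms then have integrals at most
    [8 ^- n], so [D_n <= C / 4 ^+ n] almost everywhere, the increments of
    [ln u_n] are of order [2 ^- n], and [ln u_n] converges. The inequality for
    the limit [s] comes from the one for [u_n] with the step [r_n = 2 ^- n]: it
    vanishes in the limit, but so does the error [e_n / r_n]. *)
Lemma log_optimal : exists (u_ : nat -> T -> R) (s : T -> R),
  [/\ forall n, K (u_ n), measurable_fun setT s, forall x, 0 < s x,
      \forall x \ae P, (fun n => u_ n x) @ \oo --> s x &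
      forall v, K v -> integrable (fun x => v x / s x * f x) /\
        \int[P]_x (v x / s x * f x) <= 1].
Proof.
pose e n : R := a * (8^-1) ^+ n.
have e_gt0 n : 0 < e n by rewrite mulr_gt0// exprn_gt0.
have /choice[u_ u_P] : forall n, exists u, K u /\ sup_L - e n <= L u.
  by move=> n; have [u Ku /ltW h] := near_optimal (e_gt0 n); exists u.
have Ku n := (u_P n).1; have Lu n := (u_P n).2.
have e_noninc n : e n.+1 <= e n.
  rewrite ler_pM2l// exprS ler_piMl ?exprn_ge0//; lra.
pose D n x :=
  ln ((u_ n x + u_ n.+1 x) / 2) - (ln (u_ n x) + ln (u_ n.+1 x)) / 2.
have D_gap n x : 0 <= D n x /\ (ln (u_ n x) - ln (u_ n.+1 x)) ^+ 2 <=
    32 * (D n x * expR (D n x)).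
  have := ln_midpoint_gap (ln (u_ n x)) (ln (u_ n.+1 x)).
  by rewrite !lnK ?posrE ?K_gt0.
have cvg_ln : \forall x \ae P, cvgn (fun n => ln (u_ n x)).
  have iD n : integrable (D n) /\ a * \int[P]_x D n x <= e n.
    apply: midpoint_gap => //; apply: le_trans (Lu n.+1).
    by rewrite lerB.
  have := @ae_bounded_geometric _ _ _ P (fun n x => 4 ^+ n * D n x).
  have H1 n : integrable (fun x => 4 ^+ n * D n x).
    exact: (RintegrableZl (4 ^+ n) (iD n).1).
  have H2 n x : 0 <= 4 ^+ n * D n x.
    by rewrite mulr_ge0 ?exprn_ge0 ?(D_gap n x).1.
  have H3 n : \int[P]_x (4 ^+ n * D n x) <= (2^-1) ^+ n.
    have [h1 h2] := iD n.
    rewrite RintegralZl//.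
    apply: (@le_trans _ _ (4 ^+ n * (8^-1) ^+ n)).
      by rewrite ler_pM2l ?exprn_gt0// -(ler_pM2l a_gt0).
    by rewrite -exprMn; apply: lerXn2r; rewrite ?nnegrE; lra.
  move=> /(_ H1 H2 H3); apply: filterS => x [C DC].
  have C0 : 0 <= C by apply: le_trans (DC 0%N).
  apply: (@cvg_geometric_increments _ _ (Num.sqrt (32 * (C * expR C)))) => n.
  have [D0 h] := D_gap n x.
  rewrite -ler_sqr ?nnegrE ?divr_ge0 ?sqrtr_ge0 ?exprn_ge0//.
  rewrite real_normK ?num_real// exprMn sqr_sqrtr; last first.
    by rewrite !mulr_ge0 ?expR_ge0.
  rewrite -sqrrN opprB; apply: (le_trans h).
  rewrite -exprVn -exprM mulnC exprM -mulrA ler_pM2l//.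
  have -> : (2^-1) ^+ 2 = 4^-1 :> R by field.
  have Dn : D n x <= C * (4^-1) ^+ n.
    by rewrite exprVn ler_pdivlMr ?exprn_gt0// mulrC.
  have DC' : D n x <= C.
    by apply: (le_trans Dn); rewrite ler_piMr// exprn_ile1//; lra.
  by rewrite mulrAC; apply: ler_pM => //; rewrite ?expR_ge0 ?ler_expR.
(* The upper limit is measurable on the whole space, and its exponential is
   positive also where the sequence diverges. *)
pose s x := expR (fine (limn_esup (fun n => (ln (u_ n x))%:E))).
have ms : measurable_fun setT s.
  apply: measurableT_comp => //; apply: measurableT_comp => //.
  apply: measurable_fun_limn_esup => n; apply/measurable_EFinP.
  by apply: measurableT_comp => //; exact: K_measurable.
have s0 x : 0 < s x by exact: expR_gt0.
have us : \forall x \ae P, (fun n => u_ n x) @ \oo --> s x.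
  apply: filterS cvg_ln => x /cvg_ex[l lnl].
  have -> : s x = expR l.
    rewrite /s; have /cvg_limn_einf_sup[_ ->]// :
      (fun n => (ln (u_ n x))%:E) @ \oo --> l%:E.
    by apply: cvg_EFin; [apply: nearW|].
  rewrite (_ : (fun n => u_ n x) = (fun n => expR (ln (u_ n x)))); last first.
    by apply/funext => n; rewrite lnK ?posrE ?K_gt0.
  by apply: continuous_cvg => //; exact: continuous_expR.
exists u_, s; split => // v Kv.
pose r n : R := (2^-1) ^+ n.
have r0 n : 0 < r n by rewrite exprn_gt0.
have mv := K_measurable Kv.
have rP n := near_optimal_ratio (Ku n) Kv (r0 n) (Lu n).
have cr : r @ \oo --> 0.
  by apply: cvg_expr; rewrite ger0_norm; lra.
apply: (@Rfatou _ _ _ P \oo _ _ (fun n => a * (4^-1) ^+ n + 1) 1 _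
  (fun A ooA => ooA) (fun n => (rP n).1)).
- apply: measurable_funM => //; apply: measurable_funM => //.
  exact: measurable_inv_pos.
- move=> n; apply: nearW => x.
  have h := f_gt0 x; have h1 := K_gt0 x Kv; have h2 := K_gt0 x (Ku n).
  by rewrite mulr_ge0 ?divr_ge0 ?addr_ge0 ?mulr_ge0 ?ltW.
- apply: filterS us => x ux.
  apply: cvgM; last exact: cvg_cst.
  apply: cvgM; first exact: cvg_cst.
  apply: cvgV; first by rewrite gt_eqF.
  rewrite -[X in _ --> X]addr0 -(mul0r (v x)); apply: cvgD => //.
  by apply: cvgM => //; exact: cvg_cst.
- move=> n; apply: (le_trans (rP n).2); rewrite lerD2r /e /r -mulrA ler_pM2l//.
  rewrite -exprVn invrK -exprMn; apply: lerXn2r; rewrite ?nnegrE; lra.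
- rewrite -[X in _ --> X]add0r -(mulr0 a); apply: cvgD; last exact: cvg_cst.
  by apply: cvgM; [exact: cvg_cst|apply: cvg_expr; rewrite ger0_norm; lra].
Qed.

End log_optimal.

(** * Limits of densities in the dual of L^oo *)

Section dual_limits.
Context d (T : measurableType d) (R : realType) (P : probability T R).

Local Notation integrable f := (P.-integrable setT (EFin \o f)).

Lemma integrable_L1 (f : L1 P) : integrable f.
Proof. by apply/Lfun1_integrable/LfunP. Qed.

Lemma L1_rep (f : T -> R) : integrable f -> exists F : L1 P, F = f :> (T -> R).
Proof.
move=> /Lfun1_integrable fL; exists (Lfun_Sub (lexx 1%E) fL).
exact: Lfun_valP.
Qed.

Lemma Loo_rep (f : T -> R) (c : R) : measurable_fun setT f ->
  (\forall x \ae P, `|f x| <= c) -> exists F : Loo P, F = f :> (T -> R).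
Proof.
move=> mf fc; suff fL : f \in Lfun P +oo%E.
  by exists (Lfun_Sub (leey 1%E) fL); exact: Lfun_valP.
apply/andP; split; rewrite inE//=.
rewrite /finite_norm unlock [X in (0 < X)%E]probability_setT lte01.
apply: (@le_lt_trans _ _ c%:E); last exact: ltry.
by apply/ess_supP; apply: filterS fc => x /=; rewrite lee_fin.
Qed.

Lemma integrable_pairing_fun (u : T -> R) (phi : Loo P) : integrable u ->
  integrable (fun x => u x * phi x).
Proof.
move=> iu; apply: integrableM_bounded iu (measurable_Loo phi) (ae_le_normoo phi).
Qed.

Lemma dualLoo_rep (H : Loo P -> R) : linear_for *%R H ->
  (exists M, forall phi, `|H phi| <= M * normoo P phi) ->
  exists h : dualLoo P, forall phi, h phi = H phi.
Proof.
move=> linH bH.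
pose Hl : {scalar (Loo P)} :=
  HB.pack H (GRing.isLinear.Build R (Loo P) R *%R H linH).
by exists (@DualLoo _ _ _ P Hl bH).
Qed.

Lemma bounded_ultra_cvg (F : set_system nat) (u : R^nat) (c : R) :
  UltraFilter F -> (forall n, `|u n| <= c) -> exists l : R, u @ F --> l.
Proof.
move=> UF uc.
have uF : (u @ F) `[- c, c]%classic.
  by apply: (@nearW _ F) => n /=; rewrite in_itv/= -ler_norml.
have [l [_ lF]] := @segment_compact R (- c) c (u @ F) _ uF.
exists l => A Al; have [//|FA] := in_ultra_setVsetC (u @^-1` A) UF.
by have [x [/= Ax nAx]] := lF (~` A) A FA Al.
Qed.

Lemma density_pairing_le (h : L1 P) (phi : Loo P) : density P h ->
  `|pairing P h phi| <= normoo P phi.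
Proof.
move=> [_ h0 h1]; have ih := integrable_L1 h.
have ihp := integrable_pairing_fun phi ih.
apply: (le_trans (le_normr_Rintegral measurableT ihp)).
have -> : normoo P phi = \int[P]_x (h x * normoo P phi).
  by rewrite RintegralZr// h1 mul1r.
apply: ae_le_Rintegral.
- exact: integrable_normr ihp.
- exact: RintegrableZr.
- apply: filterS2 h0 (ae_le_normoo phi) => x hx px.
  by rewrite normrM ger0_norm// ler_wpM2l.
Qed.

(** A limit point of a sequence of densities in the dual of [L^oo]. Along an
    ultrafilter every bounded real sequence converges, so all the pairings with
    elements of [L^oo] converge simultaneously, and the limits depend linearly
    on the test function. *)
Lemma density_ultralimit (h_ : nat -> L1 P) : (forall n, density P (h_ n)) ->
  exists (F : set_system nat) (h : dualLoo P),
    [/\ ProperFilter F, F `=>` \oo, dual_ge0 h &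
        forall phi : Loo P, (fun n => pairing P (h_ n) phi) @ F --> h phi].
Proof.
move=> dh; have [F [UF Foo]] := @ultraFilterLemma nat \oo _.
have PF := @ultra_proper _ _ UF.
have /choice[H HP] : forall phi : Loo P, exists l : R,
    (fun n => pairing P (h_ n) phi) @ F --> l.
  move=> phi; apply: (@bounded_ultra_cvg _ _ (normoo P phi)) => n.
  exact: density_pairing_le.
have linH : linear_for *%R H.
  move=> a phi psi; apply: (cvg_unique (@Rhausdorff R) (HP _)).
  rewrite /= (funext (fun n => pairingD (h_ n) a phi psi)).
  by apply: cvgD (HP psi); apply: cvgM (HP phi); exact: cvg_cst.
have bH : exists M, forall phi, `|H phi| <= M * normoo P phi.
  exists 1 => phi; rewrite mul1r.
  apply: (cvgr_to_le (cvg_norm (HP phi))); apply: nearW => n.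
  exact: density_pairing_le.
have [h hH] := dualLoo_rep linH bH.
exists F, h; split => // [phi phi0|phi]; last by rewrite hH.
rewrite hH /=; apply: (cvgr_to_ge (HP phi)); apply: nearW => n.
by apply: pairing_ge0 => //; have [] := dh n.
Qed.

Section ac_part_limit.
Variables (u_ : nat -> L1 P) (s : L1 P) (F : set_system nat) (l : dualLoo P).
Hypotheses (PF : ProperFilter F) (Foo : F `=>` \oo).
Hypothesis u_ge0 : forall n, ae_ge0 P (u_ n).
Hypothesis u_cvg : \forall x \ae P, (fun n => u_ n x) @ \oo --> s x.
Hypothesis u_weak : forall phi : Loo P,
  (fun n => pairing P (u_ n) phi) @ F --> l phi.

Let s_ge0 : ae_ge0 P s.
Proof.
apply: filterS2 (ae_foralln u_ge0) u_cvg => x ux uc.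
by apply: (cvgr_to_ge uc); apply: nearW.
Qed.

Let pairing_le (phi : Loo P) : ae_ge0 P phi -> pairing P s phi <= l phi.
Proof.
move=> phi0.
have [] := @Rfatou _ _ _ P F (fun n x => u_ n x * phi x) (fun x => s x * phi x)
  (fun n => pairing P (u_ n) phi) (l phi) PF Foo.
- by move=> n; apply: integrable_pairing_fun; exact: integrable_L1.
- by apply: measurable_funM; [exact: measurable_L1|exact: measurable_Loo].
- by move=> n; apply: filterS2 (u_ge0 n) phi0 => x; exact: mulr_ge0.
- by apply: filterS u_cvg => x ux; apply: cvgM ux (cvg_cst _).
- by [].
- exact: u_weak.
by [].
Qed.

Let B (N : nat) : set T := \bigcap_n [set x | u_ n x <= N%:R].

Let mB N : measurable (B N).
Proof.
apply: bigcap_measurable => // n _.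
rewrite (_ : [set _ | _] = u_ n @^-1` `]-oo, N%:R]%classic); last first.
  by apply/seteqP; split => x; rewrite /= in_itv.
by rewrite -[X in measurable X]setTI; exact: measurable_L1.
Qed.

Let B_full : \forall x \ae P, \forall N \near \oo, B N x.
Proof.
apply: filterS u_cvg => x ux.
have [C [_ HC]] : bounded_fun (fun n => u_ n x).
  by apply: cvg_seq_bounded; apply/cvg_ex; exists (s x).
have := nbhs_infty_ger (C + 1); apply: filterS => N CN n _ /=.
apply: le_trans CN; apply: le_trans (ler_norm _) _.
by apply: HC => //; rewrite ltrDl.
Qed.

(** An almost everywhere limit [s] is the absolutely continuous part of any
    weak limit [l]. By Fatou's lemma [k := l - s] is positive. On the set [B N]
    where all the [u_n] are at most [N] convergence is dominated, so [k]
    vanishes there; since almost every point is in [B N] for large [N], an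
    [L^1] function has little mass outside of [B N], and [k] is disjoint from it. *)
Lemma ac_part_ae_limit : ac_part l s.
Proof.
split; first exact: s_ge0.
have [k kE] : exists k : dualLoo P, forall phi, k phi = l phi - L1_dual s phi.
  apply: dualLoo_rep => [a phi psi|].
    rewrite (linearP l) (linearP (L1_dual s)) /=; ring.
  have [M1 H1] := dual_bounded l; have [M2 H2] := dual_bounded (L1_dual s).
  exists (M1 + M2) => phi; rewrite mulrDl (le_trans (ler_normB _ _))// lerD//.
exists k; split; last by move=> phi; rewrite kE addrC subrK.
  by move=> phi phi0; rewrite /= kE subr_ge0; exact: pairing_le.
move=> f f0; split.
- by move=> phi phi0; rewrite /= kE subr_ge0; exact: pairing_le.
- by move=> phi phi0; exact: pairing_ge0.
move=> m mk mf phi phi0 /=.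
have /choice[phiB phiBE] : forall N, exists G : Loo P,
    G = (fun x => phi x * \1_(B N) x) :> (T -> R).
  move=> N.
  apply: (@Loo_rep _ (normoo P phi)).
    apply: measurable_funM; first exact: measurable_Loo.
    exact: measurable_indic.
  apply: filterS (ae_le_normoo phi) => x px.
  rewrite indicE; case: (x \in B N); rewrite ?mulr1// mulr0 normr0.
  exact: normoo_ge0.
have phiB0 N : ae_ge0 P (phiB N).
  by apply: filterS phi0 => x px; rewrite phiBE mulr_ge0.
have phiBc0 N : ae_ge0 P (phi - phiB N).
  apply: filterS phi0 => x px.
  rewrite (_ : (phi - phiB N) x = phi x - phiB N x)// phiBE indicE.
   case: (x \in B N); rewrite ?mulr1 ?subrr//.
  by rewrite mulr0 subr0.
have kB N : k (phiB N) = 0.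
  have [||_ _ h] := @Rdominated_convergence _ _ _ P (fun n x => u_ n x * phiB N x)
    (fun x => s x * phiB N x) (fun=> N%:R * normoo P phi)
    (fun n => measurable_funM (measurable_L1 (u_ n)) (measurable_Loo (phiB N)))
    (measurable_funM (measurable_L1 s) (measurable_Loo (phiB N))) _
    (Rintegrable_cst P _).
  - by apply: filterS u_cvg => x ux; apply: cvgM ux (cvg_cst _).
  - move=> n; apply: filterS2 (u_ge0 n) (ae_le_normoo phi) => x ux px.
    rewrite phiBE indicE; have [/set_mem xB|_] := boolP (x \in B N).
      rewrite mulr1 normrM ger0_norm//; apply: ler_pM => //; exact: xB.
    by rewrite !mulr0 normr0 mulr_ge0// normoo_ge0.
  have hF : (fun n => pairing P (u_ n) (phiB N)) @ F --> pairing P s (phiB N).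
    by move=> A /h; exact: Foo.
  by rewrite kE (cvg_unique (@Rhausdorff R) (@u_weak (phiB N)) hF) subrr.
(* Only [k] matters inside [B N], and only [f] outside. *)
have m_le N : m phi <= pairing P f (phi - phiB N).
  rewrite -{1}(subrK (phiB N) phi) linearD -[leRHS]addr0 lerD//.
    exact: mf.
  by rewrite -(kB N); exact: mk.
have [||_ _ h] := @Rdominated_convergence _ _ _ P
  (fun N x => f x * (phi - phiB N) x) (fun=> 0)
  (fun x => `|f x * phi x|)
  (fun N => measurable_funM (measurable_L1 f) (measurable_Loo (phi - phiB N)))
  (measurable_cst (0 : R)) _
  (integrable_normr (integrable_pairing_fun phi (integrable_L1 f))).
- apply: filterS B_full => x Bx; apply: cvg_near_cst.
  apply: filterS Bx => N Bx.
  rewrite (_ : (phi - phiB N) x = phi x - phiB N x)// phiBE indicE mem_set//.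
  by rewrite mulr1 subrr mulr0.
- move=> N; apply: nearW => x.
  rewrite (_ : (phi - phiB N) x = phi x - phiB N x)// phiBE indicE.
  by case: (x \in B N); rewrite ?mulr1 ?subrr ?mulr0 ?subr0 ?normr0.
rewrite Rintegral_prob_cst in h.
have := cvgr_to_ge h; apply; exact: nearW.
Qed.

End ac_part_limit.
End dual_limits.

(** * Truncated densities *)

Section truncation.
Context d (T : measurableType d) (R : realType) (P : probability T R).

Lemma ae_increases_to_le (g_ : (T -> R)^nat) (g : T -> R) :
  ae_increases_to P g_ g -> forall n, \forall x \ae P, g_ n x <= g x.
Proof.
move=> incr n; apply: filterS incr => x [mono gx].
apply: (cvgr_to_ge gx); have := nbhs_infty_ge n.
by apply: filterS => m nm; exact: mono.
Qed.

Lemma truncation_cvg (y : R) : 0 <= y ->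
  (fun n : nat => Num.max 0 (Num.min y n%:R)) @ \oo --> y.
Proof.
move=> y0; apply: cvg_near_cst; have := nbhs_infty_ger y.
by apply: filterS => n /= yn; rewrite (min_idPl yn) (max_idPr y0).
Qed.

Lemma measurable_truncation (f : T -> R) (n : nat) : measurable_fun setT f ->
  measurable_fun setT (fun x => Num.max 0 (Num.min (f x) n%:R)).
Proof.
by move=> mf; apply: measurable_maxr => //; exact: measurable_minr.
Qed.

Lemma truncation_bounded (y : R) (n : nat) :
  `|Num.max 0 (Num.min y n%:R)| <= n%:R.
Proof. by rewrite ger0_norm ?ge_max ?ler0n ?ge_min ?lexx ?orbT// le_max lexx. Qed.

Lemma truncation_Loo (g : L1 P) : ae_ge0 P g -> exists g_ : (Loo P)^nat,
  (forall n, ae_ge0 P (g_ n)) /\ ae_increases_to P (fun n => g_ n) g.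
Proof.
move=> g0.
have /choice[g_ g_E] : forall n : nat, exists G : Loo P,
    G = (fun x => Num.max 0 (Num.min (g x) n%:R)) :> (T -> R).
  move=> n; apply: (@Loo_rep _ _ _ P _ n%:R).
    by apply: measurable_truncation; exact: measurable_L1.
  by apply: nearW => x; exact: truncation_bounded.
exists g_; split.
  by move=> n; apply: nearW => x; rewrite g_E le_max lexx.
apply: filterS g0 => x gx; split.
  move=> m n mn /=; rewrite !g_E ge_max le_max lexx/=.
  have -> : Num.min (g x) m%:R <= Num.max 0 (Num.min (g x) n%:R).
    by rewrite le_max le_min !ge_min lexx ler_nat mn !orbT.
  by [].
rewrite (_ : (fun n => g_ n x) = fun n => Num.max 0 (Num.min (g x) n%:R)).
  exact: truncation_cvg.
by apply/funext => n; rewrite g_E.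
Qed.

(** Truncate [f], mix it with a small weight [t] of the constant density, and
    restore the total mass by an additive constant [k]. *)
Lemma density_bounded_approx (f : T -> R) (e : R) : density P f -> 0 < e ->
  exists (f' : T -> R) (a b : R),
    [/\ measurable_fun setT f', 0 < a, forall x, a <= f' x <= b,
        \int[P]_x f' x = 1 & \int[P]_x `|f x - f' x| < e].
Proof.
move=> [/Lfun1_integrable intf f0 If] e0.
have mf := integrable_measurable intf.
pose f_ (n : nat) x := Num.max 0 (Num.min (f x) n%:R).
have mf_ n : measurable_fun setT (f_ n) by exact: measurable_truncation.
have f_ge0 n x : 0 <= f_ n x by rewrite le_max lexx.
have f_bounded n : \forall x \ae P, `|f_ n x| <= n%:R.
  by apply: nearW => x; exact: truncation_bounded.
have f_le n : \forall x \ae P, f_ n x <= f x.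
  by apply: filterS f0 => x fx; rewrite /f_ ge_max fx ge_min lexx.
have intf_ n : P.-integrable setT (EFin \o f_ n).
  exact: integrable_bounded (f_bounded n).
have [||_ cf _] := @Rdominated_convergence _ _ _ P f_ f f mf_ mf _ intf.
- by apply: filterS f0 => x fx; exact: truncation_cvg.
- by move=> n; apply: filterS (f_le n) => x; rewrite ger0_norm.
(* The error is at most [2 dn + 2 t]. *)
have e4 : 0 < e / 4 by lra.
have [n _ /(_ n (leqnn n)) /=] := cvgr_lt 0 cf _ e4.
set dn := \int[P]_x _ => dn_lt.
pose c := \int[P]_x f_ n x.
have c1 : 1 - c <= dn.
  rewrite -If /c -RintegralB//; apply: ae_le_Rintegral.
  - exact: RintegrableB.
  - by apply: integrable_normr; exact: RintegrableB.
  - by apply: nearW => x; rewrite distrC ler_norm.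
have c_le1 : c <= 1 by rewrite -If; apply: ae_le_Rintegral.
have c_ge0 : 0 <= c by apply: ae_Rintegral_ge0 => //; exact: nearW.
pose t : R := Num.min (e / 8) (1 / 2).
have t0 : 0 < t by rewrite lt_min; apply/andP; split; lra.
have t8 : t <= e / 8 by rewrite ge_min lexx.
have t2 : t <= 1 / 2 by rewrite ge_min lexx orbT.
pose k : R := 1 - (1 - t) * c.
have kt : t <= k by rewrite /k; nra.
have intZ := RintegrableZl (1 - t) (intf_ n).
have intk := Rintegrable_cst P k.
exists (fun x => (1 - t) * f_ n x + k), k, ((1 - t) * n%:R + k); split.
- by apply: measurable_funD => //; exact: measurable_funM.
- lra.
- move=> x; have h := f_ge0 n x.
  have h' : f_ n x <= n%:R.
    by apply: le_trans (truncation_bounded (f x) n); exact: ler_norm.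
  by apply/andP; split; nra.
- by rewrite RintegralD// RintegralZl// Rintegral_prob_cst /k -/c addrC subrK.
have intd : P.-integrable setT (EFin \o (fun x => `|f_ n x - f x|)).
  by apply: integrable_normr; exact: RintegrableB.
have intt := RintegrableZl t (intf_ n).
have : \int[P]_x `|f x - ((1 - t) * f_ n x + k)| <=
    \int[P]_x (`|f_ n x - f x| + (t * f_ n x + k)).
  apply: ae_le_Rintegral.
  - by apply: integrable_normr; apply: RintegrableB => //; exact: RintegrableD.
  - by apply: RintegrableD => //; exact: RintegrableD.
  apply: nearW => x.
  have -> : f x - ((1 - t) * f_ n x + k) = (f x - f_ n x) + (t * f_ n x - k).
    by ring.
  rewrite (le_trans (ler_normD _ _))// distrC lerD2l.
  rewrite (le_trans (ler_normB _ _))//.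
  have h1 : 0 <= t * f_ n x by rewrite mulr_ge0// ltW.
  have h2 : 0 <= k by apply: le_trans kt; exact: ltW.
  by rewrite (ger0_norm h1) (ger0_norm h2).
have -> : \int[P]_x (`|f_ n x - f x| + (t * f_ n x + k)) = dn + (t * c + k).
  rewrite RintegralD//; last exact: RintegrableD.
  by rewrite RintegralD// RintegralZl// Rintegral_prob_cst.
by move=> /le_lt_trans; apply; rewrite /k; nra.
Qed.

End truncation.

(** * Coarsenings and coarse densities *)

Section coarsening.
Context (R : realType) (dX dY : measure_display).
Context (X : measurableType dX) (Y : measurableType dY).
Context (P : probability X R) (Q : probability Y R) (S : coarsening P Q).

Local Notation integrable f := (P.-integrable setT (EFin \o f)).

Lemma coars_lincomb (a b : R) (h k : L1 Q) :
  \forall x \ae P, S (a *: h + b *: k) x = a * S h x + b * S k x.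
Proof.
have [_ lin] := coars_linear S.
have S0 : \forall x \ae P, S 0 x = 0.
  apply: filterS (lin 1 0 0) => x /(_ I); rewrite scale1r addr0 => e.
  have : S 0 x = S 0 x + S 0 x by rewrite {1}e/= scale1r.
  by move=> /eqP; rewrite eq_sym -subr_eq0 addrK => /eqP.
have SZ : \forall x \ae P, S (b *: k) x = b * S k x.
  have := lin b k 0; apply: filterS2 S0 => x S0x /(_ I).
  rewrite addr0 => ->.
  by rewrite (_ : (b *: S k + S 0) x = b * S k x + S 0 x)// S0x addr0.
have := lin a h (b *: k); apply: filterS2 SZ => x SZx /(_ I) ->.
by rewrite (_ : (a *: S h + S (b *: k)) x = a * S h x + S (b *: k) x)// SZx.
Qed.

Lemma coars_adj_cst1 (h : dualLoo Q) :
  h (coars_adj S (Loocst P 1)) = h (Loocst Q 1).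
Proof. by apply: dual_ae; exact: coars_adj1. Qed.

Lemma coars_adj_ge0 (phi : Loo P) : ae_ge0 P phi -> ae_ge0 Q (coars_adj S phi).
Proof.
move=> phi0; apply: Loo_ge0P => h h0; rewrite -coars_adjE.
by apply: pairing_ge0 => //; exact: coars_ge0.
Qed.

Lemma pairing_cst1 d (T : measurableType d) (M : probability T R) (f : L1 M) :
  pairing M f (Loocst M 1) = \int[M]_x f x.
Proof. by apply: eq_Rintegral => x _; rewrite mulr1. Qed.

Lemma coars_mass (h : L1 Q) : \int[P]_x S h x = \int[Q]_y h y.
Proof.
rewrite -!pairing_cst1 coars_adjE.
exact: (coars_adj_cst1 (L1_dual h)).
Qed.

Lemma density_lincomb (a b : R) (h k : L1 Q) : 0 <= a -> 0 <= b ->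
  ae_ge0 Q h -> ae_ge0 Q k -> a * \int[Q]_y h y + b * \int[Q]_y k y = 1 ->
  density Q (a *: h + b *: k).
Proof.
move=> a0 b0 h0 k0 e1; split; first exact: LfunP.
  by apply: filterS2 h0 k0 => y hy ky; rewrite /= addr_ge0// mulr_ge0.
have ih := integrable_L1 h; have ik := integrable_L1 k.
apply: etrans e1; rewrite -!RintegralZl// -RintegralD//; exact: RintegrableZl.
Qed.

(** Boundedness away from zero makes the logarithm integrable. Measurability
    and the lower bound are imposed everywhere, on a representative of [S h], so
    that pointwise operations need no exceptional null set. *)
Definition coarse_density : set (X -> R) := [set u : X -> R | [/\
  measurable_fun setT u,
  exists2 c, 0 < c & forall x, c <= u x &
  exists2 h : L1 Q, density Q h & \forall x \ae P, u x = S h x]].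

Lemma coarse_density_rep (h : L1 Q) (c : R) : density Q h -> 0 < c ->
  (\forall x \ae P, c <= S h x) ->
  exists2 u, coarse_density u & \forall x \ae P, u x = S h x.
Proof.
move=> dh c0 cS; have e : \forall x \ae P, Num.max (S h x) c = S h x.
  by apply: filterS cS => x /max_idPl.
exists (fun x => Num.max (S h x) c) => //; split.
- by apply: measurable_maxr => //; exact: measurable_L1.
- by exists c => // x; rewrite le_max lexx orbT.
- by exists h.
Qed.

Lemma density_cst1 : density Q (L1cst Q 1).
Proof.
split; first exact: LfunP.
- by apply: nearW => y; exact: ler01.
- exact: Rintegral_prob_cst.
Qed.

Lemma coarse_density_cst1 : coarse_density (cst 1).
Proof.
split => //; first by exists 1.
exists (L1cst Q 1); first exact: density_cst1.
by apply: filterS (coars1 S) => x /(_ I) ->.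
Qed.

Lemma coarse_density_integrable u : coarse_density u ->
  integrable u /\ \int[P]_x u x = 1.
Proof.
move=> [mu _ [h dh uS]]; have [_ h0 h1] := dh; split; last first.
  rewrite (ae_eq_Rintegral mu _ uS) ?coars_mass//; exact: measurable_L1.
apply: integrable_dominated mu _ (integrable_normr (integrable_L1 (S h))).
by apply: filterS uS => x ->.
Qed.

Lemma coarse_density_convex u v (r : R) : 0 < r ->
  coarse_density u -> coarse_density v ->
  coarse_density (fun x => (u x + r * v x) / (1 + r)).
Proof.
move=> r0 [mu [c c0 cu] [h dh uS]] [mv [c' c'0 c'v] [k dk vS]].
have r1 : 0 < 1 + r by lra.
have [_ h0 h1] := dh; have [_ k0 k1] := dk.
split.
- apply: measurable_funM => //; apply: measurable_funD => //.
  exact: measurable_funM.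
- exists (c / (1 + r)); first by rewrite divr_gt0.
  move=> x; rewrite ler_pM2r ?invr_gt0//; have := cu x; have := c'v x; nra.
exists ((1 + r)^-1 *: h + (r / (1 + r)) *: k).
  apply: density_lincomb => //.
  - by rewrite invr_ge0 ltW.
  - by rewrite divr_ge0//; exact: ltW.
  - by rewrite h1 k1; field; rewrite gt_eqF.
have := coars_lincomb (1 + r)^-1 (r / (1 + r)) h k.
apply: filterS3 uS vS => x -> -> ->.
by field; rewrite gt_eqF.
Qed.

Section adjoint.
Variables (Sx : L1 P -> L1 Q) (Sx_adj : adj_L1 S Sx).

(** This is the duality between [S] and [S^*] for a [g] that may be unbounded.
    It is obtained from bounded truncations of [g]: their images under [S^*]
    increase to [S^* g = 1], and Fatou's lemma makes [g * S h] integrable. *)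
Lemma CAR_mass (g : L1 P) (h : L1 Q) : ae_ge0 P g -> Sx g = cst 1 %[ae Q] ->
  ae_ge0 Q h -> integrable (fun x => g x * S h x) /\
  \int[P]_x (g x * S h x) = \int[Q]_y h y.
Proof.
move=> g0 Sg1 h0; have [g_ [g_0 g_incr]] := truncation_Loo g0.
have Sg_incr := adj_L1_increasing Sx_adj g_0 g_incr.
have Sg_le1 n : \forall y \ae Q, coars_adj S (g_ n) y <= 1.
  apply: filterS2 (ae_increases_to_le Sg_incr n) Sg1 => y + /(_ I) Sgy.
  by rewrite Sgy.
have Sh0 := coars_ge0 S h0.
have S_cvg : (fun n => \int[P]_x (S h x * g_ n x)) @ \oo --> \int[Q]_y h y.
  have [||_ _] := @Rdominated_convergence _ _ _ Q
    (fun n y => h y * coars_adj S (g_ n) y)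
    h h (fun n => measurable_funM (measurable_L1 h) (measurable_Loo _))
    (measurable_L1 h) _ (integrable_L1 h).
  - apply: filterS2 Sg_incr Sg1 => y [_ cvy] /(_ I) Sgy.
    rewrite -[X in _ --> X]mulr1; apply: cvgM; first exact: cvg_cst.
    by rewrite Sgy in cvy.
  - move=> n; apply: filterS3 h0 (coars_adj_ge0 (g_0 n)) (Sg_le1 n).
    move=> y hy Sy le1.
    by rewrite ger0_norm ?mulr_ge0// ler_piMr.
  rewrite (_ : (fun n => _) = fun n => \int[P]_x (S h x * g_ n x))//.
  by apply/funext => n; rewrite -/(pairing _ _ _) -coars_adjE.
have igh : integrable (fun x => g x * S h x).
  apply: (@proj1 _ (\int[P]_x (g x * S h x) <= \int[Q]_y h y)).
  apply: (@Rfatou _ _ _ P \oo (fun n x => S h x * g_ n x) _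
    (fun n => \int[P]_x (S h x * g_ n x)) _ _ (fun A ooA => ooA)) => //.
  - by move=> n; apply: integrable_pairing_fun; exact: integrable_L1.
  - by apply: measurable_funM; exact: measurable_L1.
  - by move=> n; apply: filterS2 Sh0 (g_0 n) => x; exact: mulr_ge0.
  - apply: filterS g_incr => x [_ cvx]; rewrite mulrC.
    by apply: cvgM cvx; exact: cvg_cst.
split => //.
have [||_ _] := @Rdominated_convergence _ _ _ P (fun n x => S h x * g_ n x)
    (fun x => g x * S h x) _
    (fun n => measurable_funM (measurable_L1 _) (measurable_Loo _))
    (measurable_funM (measurable_L1 _) (measurable_L1 _)) _ igh.
- apply: filterS g_incr => x [_ cvx]; rewrite mulrC.
  by apply: cvgM cvx; exact: cvg_cst.
- move=> n; apply: filterS3 Sh0 (g_0 n) (ae_increases_to_le g_incr n).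
  move=> x Shx gx le; rewrite ger0_norm ?mulr_ge0// mulrC.
  exact: ler_wpM2r.
exact: (fun h => cvg_unique (@Rhausdorff R) h S_cvg).
Qed.

Lemma CAR_sub_density : CAR S Sx `<=` density P.
Proof.
move=> p [h [g [dh g0 Sg1 ->]]]; have [_ h0 h1] := dh.
have [igh I] := CAR_mass g0 Sg1 h0.
split; [exact/Lfun1_integrable| |exact: etrans I h1].
by apply: filterS2 g0 (coars_ge0 S h0) => x; exact: mulr_ge0.
Qed.

Hypothesis A1 : forall h' : dualLoo Q,
  dual_ge0 h' -> ac_part_gt0 (coars_dual S h') ->
  exists h : dualLoo Q, [/\ dual_ge0 h,
    dual_eq (coars_dual S h) (coars_dual S h') & ac_part_gt0 h].

(** Let [h'] be a weak limit of [h_n]; the absolutely continuous part of [S h']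
    is [s]. (A1) gives [h = f + k] with the same image and [f > 0]. For the
    truncations [g_n] of [g],
    [int s g_n <= <S h', g_n> = <h, S^* g_n> <= int f (S^* g_n) + k 1], where
    [k 1 = 1 - int f]. In the limit [1 <= int f (S^* g) + 1 - int f], so
    [f (1 - S^* g)], which is nonnegative, has a nonpositive integral. *)
Lemma saturation (h_ : nat -> L1 Q) (s g : L1 P) :
  (forall n, density Q (h_ n)) ->
  ae_gt0 P s -> (\forall x \ae P, (fun n => S (h_ n) x) @ \oo --> s x) ->
  ae_ge0 P g -> integrable (fun x => s x * g x) ->
  \int[P]_x (s x * g x) = 1 -> (\forall y \ae Q, Sx g y <= 1) ->
  Sx g = cst 1 %[ae Q].
Proof.
move=> dh s0 Shs g0 isg Isg Sg1.
have [F [h' [PF Foo h'0 h'E]]] := density_ultralimit dh.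
have h'_ac : ac_part (coars_dual S h') s.
  apply: (ac_part_ae_limit PF Foo _ Shs) => [n|phi].
    by apply: coars_ge0; have [] := dh n.
  rewrite (_ : (fun n => _) = fun n => pairing Q (h_ n) (coars_adj S phi)).
    exact: h'E.
  by apply/funext => n; rewrite coars_adjE.
have [h [h0 hh' [f [f0 [k [k0 _ hE]]] f_gt0]]] : exists h : dualLoo Q,
    [/\ dual_ge0 h, dual_eq (coars_dual S h) (coars_dual S h') & ac_part_gt0 h].
  by apply: A1 => //; exists s.
have h1 : h (Loocst Q 1) = 1.
  rewrite -coars_adj_cst1 -[LHS]/(coars_dual S h _) hh' /= /coars_dual_fun.
  rewrite coars_adj_cst1; apply: (cvg_unique (@Rhausdorff R) (h'E (Loocst Q 1))).
  rewrite (_ : (fun n => _) = cst 1); first exact: cvg_cst.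
  by apply/funext => n; rewrite pairing_cst1; have [] := dh n.
have if_ := integrable_L1 f.
have [g_ [g_0 g_incr]] := truncation_Loo g0.
have Sg_incr := adj_L1_increasing Sx_adj g_0 g_incr.
have Sg_le1 n : \forall y \ae Q, coars_adj S (g_ n) y <= 1.
  by apply: filterS2 (ae_increases_to_le Sg_incr n) Sg1 => y; exact: le_trans.
have key n : pairing P s (g_ n) <=
    1 - \int[Q]_y f y + pairing Q f (coars_adj S (g_ n)).
  apply: (@le_trans _ _ (coars_dual S h' (g_ n))).
    have [_ [k' [k'0 _ ->]]] := h'_ac.
    by rewrite lerDl; exact: k'0.
  rewrite -hh' /= /coars_dual_fun hE addrC lerD2r.
  have -> : 1 - \int[Q]_y f y = k (Loocst Q 1).
    by have := hE (Loocst Q 1); rewrite h1 /= /L1_fun pairing_cst1; lra.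
  rewrite -subr_ge0 -linearB; apply: k0.
  apply: filterS (Sg_le1 n) => y le1.
  suff : 0 <= 1 - coars_adj S (g_ n) y by [].
  by rewrite subr_ge0.
have [||ifS _ cR] := @Rdominated_convergence _ _ _ Q
    (fun n y => f y * coars_adj S (g_ n) y)
    (fun y => f y * Sx g y) f
    (fun n => measurable_funM (measurable_L1 _) (measurable_Loo _))
    (measurable_funM (measurable_L1 _) (measurable_L1 _)) _ (integrable_L1 f).
- by apply: filterS Sg_incr => y [_ cvy]; apply: cvgM cvy; exact: cvg_cst.
- move=> n; apply: filterS3 f0 (coars_adj_ge0 (g_0 n)) (Sg_le1 n).
  move=> y fy Sy le1.
  by rewrite ger0_norm ?mulr_ge0// ler_piMr.
have [||_ _ cL] := @Rdominated_convergence _ _ _ P (fun n x => s x * g_ n x)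
    (fun x => s x * g x) _
    (fun n => measurable_funM (measurable_L1 _) (measurable_Loo _))
    (measurable_funM (measurable_L1 _) (measurable_L1 _)) _ isg.
- by apply: filterS g_incr => y [_ cvy]; apply: cvgM cvy; exact: cvg_cst.
- move=> n; apply: filterS3 s0 (g_0 n) (ae_increases_to_le g_incr n).
  move=> x /ltW sx gx le; rewrite ger0_norm ?mulr_ge0//.
  exact: ler_wpM2l.
have Ige : \int[P]_x (s x * g x) <= 1 - \int[Q]_y f y + \int[Q]_y (f y * Sx g y).
  apply: (ler_cvg_to cL); last by apply: nearW => n; exact: key.
  by apply: cvgD cR; exact: cvg_cst.
have ifB := RintegrableB if_ ifS.
have : \forall y \ae Q, f y - f y * Sx g y = 0.
  apply: ae_eq0_Rintegral => //.
    apply: filterS2 f0 Sg1 => y fy le1.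
    by rewrite subr_ge0 ler_piMr.
  by rewrite RintegralB//; rewrite Isg in Ige; lra.
apply: filterS2 f_gt0 => y fy /eqP; rewrite subr_eq0 => /eqP e _.
by apply: (mulfI (lt0r_neq0 fy)); rewrite mulr1.
Qed.

(** The approximants are [g * S h_n], where [S h_n] is a log-optimal sequence
    for [f] with almost everywhere limit [s], and [g = f / s]. *)
Lemma CAR_approx_bounded (f : X -> R) (a b e : R) :
  measurable_fun setT f -> 0 < a ->
  (forall x, a <= f x <= b) -> \int[P]_x f x = 1 -> 0 < e ->
  exists2 p, CAR S Sx p & \int[P]_x `|f x - p x| < e.
Proof.
move=> mf a0 fab If e0.
have f_ge x : a <= f x by have /andP[] := fab x.
have f_le x : f x <= b by have /andP[] := fab x.
have f_gt0 x : 0 < f x by exact: lt_le_trans (f_ge x).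
have intf : integrable f.
  apply: (@integrable_bounded _ _ _ P _ b mf); apply: nearW => x.
  by rewrite gtr0_norm.
have [u_ [s [Ku ms s_gt0 us opt]]] := log_optimal mf a0 f_ge f_le If
  (ex_intro _ _ coarse_density_cst1)
  (fun u (Ku : coarse_density u) => let: And3 mu _ _ := Ku in mu)
  (fun u (Ku : coarse_density u) => let: And3 _ cu _ := Ku in cu)
  (fun u Ku => (coarse_density_integrable Ku).1)
  (fun u Ku => (coarse_density_integrable Ku).2)
  coarse_density_convex.
have /choice[h_ h_P] : forall n, exists h : L1 Q,
    density Q h /\ \forall x \ae P, u_ n x = S h x.
  by move=> n; have [_ _ [h dh uS]] := Ku n; exists h.
have dh n := (h_P n).1.
have Shs : \forall x \ae P, (fun n => S (h_ n) x) @ \oo --> s x.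
  apply: filterS2 us (ae_foralln (fun n => (h_P n).2)) => x cvx uSx.
  by rewrite (_ : (fun n => _) = (fun n => u_ n x)) //; apply/funext => n.
have [sL sE] : exists sL : L1 P, sL = s :> (X -> R).
  apply: L1_rep; apply: (@proj1 _ (\int[P]_x s x <= 1)).
  apply: (@Rfatou _ _ _ P \oo u_ s (fun=> 1) 1 _ (fun A ooA => ooA)) => //.
  - by move=> n; exact: (coarse_density_integrable (Ku n)).1.
  - move=> n; apply: nearW => x; have [_ [c c0 cu] _] := Ku n.
    exact: le_trans (ltW c0) (cu x).
  - by move=> n; rewrite (coarse_density_integrable (Ku n)).2.
  - exact: cvg_cst.
have [g gE] : exists g : L1 P, g = (fun x => 1 / s x * f x) :> (X -> R).
  by apply: L1_rep; exact: (opt _ coarse_density_cst1).1.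
have g_ge0 x : 0 <= g x by rewrite gE mulr_ge0 ?divr_ge0 ?ltW.
have sg x : s x * g x = f x by rewrite gE; field; rewrite gt_eqF.
have g0 : ae_ge0 P g by exact: nearW.
have [g_ [g_0 g_incr]] := truncation_Loo g0.
have g_le := ae_increases_to_le g_incr.
have pairing_le (h : L1 Q) n : ae_ge0 Q h ->
    pairing P (S h) (g_ n) <= \int[Q]_y h y.
  move=> h0; have c_ge0 : 0 <= \int[Q]_y h y.
    by apply: ae_Rintegral_ge0 => //; exact: integrable_L1.
  set c := \int[Q]_y h y in c_ge0 *.
  (* [k] mixes the normalization of [h] with the constant density, so that
     [S k] is bounded away from zero and optimality applies to it. *)
  apply/ler_addgt0Pr => d d0; have cd0 : 0 < c + d by lra.
  pose k : L1 Q := (c + d)^-1 *: h + (d / (c + d)) *: L1cst Q 1.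
  have Sk : \forall x \ae P, S k x = (S h x + d) / (c + d).
    have := coars_lincomb (c + d)^-1 (d / (c + d)) h (L1cst Q 1).
    move=> lin; apply: filterS2 lin (coars1 S).
    by move=> x -> /(_ I) -> /=; field; rewrite gt_eqF.
  have dk : density Q k.
    have [_ o0 o1] := density_cst1.
    apply: density_lincomb => //.
    - by rewrite invr_ge0 ltW.
    - by rewrite divr_ge0// ltW.
    - by rewrite o1 -/c; field; rewrite gt_eqF.
  have [||v Kv vS] := @coarse_density_rep k (d / (c + d)) dk.
  - by rewrite divr_gt0.
  - apply: filterS2 Sk (coars_ge0 S h0) => x -> Shx.
    by rewrite ler_pM2r ?invr_gt0// lerDr.
  have [iv Iv] := opt v Kv.
  apply: (@le_trans _ _ (\int[P]_x ((c + d) * (v x / s x * f x)))); last first.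
    by rewrite RintegralZl//; nra.
  apply: ae_le_Rintegral.
  - by apply: integrable_pairing_fun; exact: integrable_L1.
  - exact: RintegrableZl.
  have vE : \forall x \ae P, v x = (S h x + d) / (c + d).
    by apply: filterS2 vS Sk => x -> ->.
  apply: filterS3 vE (coars_ge0 S h0) (g_le n) => x -> Shx gx.
  have -> : (c + d) * ((S h x + d) / (c + d) / s x * f x) = (S h x + d) * g x.
    by rewrite gE; field; rewrite !gt_eqF.
  by rewrite (le_trans (ler_wpM2l Shx gx))// ler_wpM2r// lerDl ltW.
have Sg_incr := adj_L1_increasing Sx_adj g_0 g_incr.
have Sg_le1 : \forall y \ae Q, Sx g y <= 1.
  have le1 n : \forall y \ae Q, coars_adj S (g_ n) y <= 1.
    have : ae_ge0 Q ((-1) *: coars_adj S (g_ n) + Loocst Q 1 : Loo Q).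
      apply: Loo_ge0P => h h0; rewrite pairingD -coars_adjE pairing_cst1.
      by rewrite mulN1r addrC subr_ge0; exact: pairing_le.
    apply: filterS => y y0.
    have : 0 <= -1 * coars_adj S (g_ n) y + 1 by [].
    by rewrite mulN1r addrC subr_ge0.
  apply: filterS2 Sg_incr (ae_foralln le1) => y [_ cvy] ley.
  by apply: (cvgr_to_le cvy); exact: nearW.
have Sg1 : Sx g = cst 1 %[ae Q].
  have sgE : (fun x => sL x * g x) = f by apply/funext => x; rewrite sE sg.
  have sL0 : ae_gt0 P sL by rewrite sE; exact: nearW.
  by apply: (saturation dh sL0) => //; rewrite ?sgE// sE.
have mass n := CAR_mass g0 Sg1 (let: And3 _ h0 _ := dh n in h0).
have : (fun n => \int[P]_x `|f x - g x * S (h_ n) x|) @ \oo --> 0.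
  apply: scheffe => //.
  - by move=> n; exact: (mass n).1.
  - move=> n; have [_ h0 _] := dh n.
    by apply: filterS (coars_ge0 S h0) => x; exact: mulr_ge0.
  - by apply: nearW => x; exact: ltW.
  - apply: filterS Shs => x cvx; rewrite -sg mulrC.
    by apply: cvgM cvx; exact: cvg_cst.
  - by move=> n; rewrite (mass n).2 If; have [] := dh n.
move=> /cvgr_lt/(_ _ e0)[n _ /(_ n (leqnn n)) /= lt_e].
by exists (g \* S (h_ n)) => //; exists (h_ n), g; split.
Qed.

End adjoint.
End coarsening.

(** * Density of the CAR model *)

Theorem theorem3p13 (R : realType) (dX dY : measure_display)
  (X : measurableType dX) (Y : measurableType dY)
  (P0 : probability X R) (Q0 : probability Y R)
  (S : coarsening P0 Q0) (Sx : L1 P0 -> L1 Q0) (Sx_adj : adj_L1 S Sx)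
  (A1 : forall h' : dualLoo Q0,
    dual_ge0 h' -> ac_part_gt0 (coars_dual S h') ->
    exists h : dualLoo Q0, [/\ dual_ge0 h,
      dual_eq (coars_dual S h) (coars_dual S h') & ac_part_gt0 h])
  (A2 : forall g : L1 P0,
    ae_ge0 P0 g -> Sx g = cst 1 %[ae Q0] -> ae_gt0 P0 g ->
    exists g_ : (L1 P0)^nat, [/\ forall n, ae_ge0 P0 (g_ n),
      forall n, Sx (g_ n) = cst (norm1 P0 (g_ n)) %[ae Q0],
      forall n, dominates P0 g (g_ n) &
      ae_increases_to P0 (fun n => g_ n) (cst 1)]) :
  L1_dense_in P0 (CAR S Sx) (density P0).
Proof.
split; first exact: CAR_sub_density.
move=> f df e e0; have e2 : 0 < e / 2 by lra.
have [f' [a [b [mf' a0 f'ab If' ff']]]] := density_bounded_approx df e2.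
have [p CARp f'p] := CAR_approx_bounded Sx_adj A1 mf' a0 f'ab If' e2.
exists p => //; have [/Lfun1_integrable intp _ _] := CAR_sub_density Sx_adj CARp.
have [/Lfun1_integrable intf _ _] := df.
have intf' : P0.-integrable setT (EFin \o f').
  apply: (@integrable_bounded _ _ _ P0 _ b mf'); apply: nearW => x.
  by have /andP[h1 h2] := f'ab x; rewrite gtr0_norm// (lt_le_trans a0).
have i1 := integrable_normr (RintegrableB intf intf').
have i2 := integrable_normr (RintegrableB intf' intp).
have i3 := integrable_normr (RintegrableB intf intp).
rewrite Lnorm1 (EFin_Rintegral i3) lte_fin.
have : \int[P0]_x `|f x - p x| <= \int[P0]_x (`|f x - f' x| + `|f' x - p x|).
  apply: ae_le_Rintegral => //; first exact: RintegrableD.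
  apply: nearW => x; rewrite (le_trans _ (ler_normD _ _))//.
  by rewrite addrA subrK.
by rewrite RintegralD// => /le_lt_trans; apply; lra.
Qed.
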